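(* Let $F$ be a probability distribution on $[0,\infty)$ with finite mean and finite variance, having a density $f$. Assume that $\frac{f(t)}{t^{\alpha}} \to C$ as $t\to 0+$, where $C\in(0,\infty)$ is a constant and $-1<\alpha<1$. Let $T_n^{NN}$ be the length of the nearest neighbor tour on $n$ cities in the mean field traveling salesman problem with intercity distance distribution $F$. Then, as $n\to\infty$, the sequence $\{T_n^{NN}-\mathbb{E}[T_n^{NN}]\}_{n}$ converges weakly (i.e. converges in distribution to some real random variable).
   Context: Mean field traveling salesman problem: there are $n$ cities $1,2,\dots,n$, and the intercity distances $L_{ij}=L_{ji}$, $1\le i<j\le n$, are i.i.d. random variables with distribution $F$ (no triangle inequality is required). Nearest neighbor (NN) tour: start at $v_1=1$; given $v_1,\dots,v_i$ with $i<n$, let $v_{i+1}$ be the city $u\notin\{v_1,\dots,v_i\}$ minimizing $L_{v_i u}$ (ties broken arbitrarily; they have probability zero when $F$ has a density); after all cities are visited, return to city $1$, i.e. $v_{n+1}=1$. The length of the NN tour is $T_n^{NN}=\sum_{i=1}^{n} L_{v_i v_{i+1}}$. *)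

(* Defs.v *)
From HB Require Import structures.
From mathcomp Require Import all_boot all_order all_algebra.
From mathcomp Require Import all_classical all_reals all_analysis.

Set Implicit Arguments.
Unset Strict Implicit.
Unset Printing Implicit Defensive.

Import Order.TTheory GRing.Theory Num.Theory.
Import numFieldNormedType.Exports.

Local Open Scope classical_set_scope.
Local Open Scope ring_scope.

(* The product rule over every subfamily of the family (X i), i \in D. *)
Definition mutually_independent (R : realType) (d : measure_display)
    (T : measurableType d) (P : probability T R) (I : finType) (D : {set I})
    (X : I -> T -> R) : Prop :=
  forall (J : {set I}) (B : I -> set R), J \subset D ->
    (forall i, i \in J -> measurable (B i)) ->
    P (\bigcap_(i in [set` J]) (X i @^-1` B i)) =
      (\prod_(i in J) P (X i @^-1` B i))%E.

Definition has_density (R : realType) (F : probability (measurableTypeR R) R)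
    (f : R -> R) : Prop :=
  [/\ measurable_fun setT f, (forall t, 0 <= f t)
    & forall A : set (measurableTypeR R), measurable A ->
        F A = (\int[lebesgue_measure]_(t in A) (f t)%:E)%E].

(* The cities 1, ..., N are represented by 'I_N with N = n.+1, so that city 1
   is ord0.  Only the off-diagonal distances L i j are constrained. *)
Definition mean_field_distances (R : realType)
    (F : probability (measurableTypeR R) R) (d : measure_display)
    (T : measurableType d) (P : probability T R) (n : nat)
    (L : 'I_n.+1 -> 'I_n.+1 -> {RV P >-> R}) : Prop :=
  [/\ (forall i j w, L i j w = L j i w),
      (forall (i j : 'I_n.+1) (A : set (measurableTypeR R)), (i < j)%N ->
         measurable A -> distribution P (L i j) A = F A)
    & mutually_independent P
        [set ij : 'I_n.+1 * 'I_n.+1 | (ij.1 < ij.2)%N]%SET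
        (fun ij w => L ij.1 ij.2 w)].

(* v 0, ..., v n are the cities in order of visit, and v n.+1 is the final
   return to city 1; the values of v beyond n.+1 are irrelevant.  Ties are not
   resolved: every tie-breaking choice satisfies the predicate. *)
Definition is_NN_tour (R : realType) (n : nat) (l : 'I_n.+1 -> 'I_n.+1 -> R)
    (v : nat -> 'I_n.+1) : Prop :=
  let unvisited (i : nat) (u : 'I_n.+1) :=
    forall k : nat, (k <= i)%N -> v k <> u in
  [/\ v 0%N = ord0, v n.+1 = ord0
    & forall i : nat, (i < n)%N ->
        unvisited i (v i.+1) /\
        (forall u, unvisited i u -> l (v i) (v i.+1) <= l (v i) u)].

Definition tour_length (R : realType) (n : nat) (l : 'I_n.+1 -> 'I_n.+1 -> R)
    (v : nat -> 'I_n.+1) : R :=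
  \sum_(i < n.+1) l (v i) (v i.+1).

(* The X n may live on different probability spaces. *)
Definition converges_weakly_to (R : realType) (d : nat -> measure_display)
    (T : forall n, measurableType (d n)) (P : forall n, probability (T n) R)
    (X : forall n, T n -> R) (mu : probability (measurableTypeR R) R) : Prop :=
  forall g : R -> R, continuous g -> (exists M : R, forall x, `|g x| <= M) ->
    ('E_(P n)[g \o X n])%E @[n --> \oo] --> (\int[mu]_x (g x)%:E)%E.

(* Main.v *)
Require Import Defs.
From HB Require Import structures.
From mathcomp Require Import all_boot all_order all_algebra.
From mathcomp Require Import fingroup perm.
From mathcomp Require Import all_classical all_reals all_analysis.
From mathcomp Require Import measurable_realfun.
From mathcomp Require Import ring lra zify.

(* Almost surely each step of the NN tour reveals edges not seen before, so its
   length is the sum of independent minima of n - 1, n - 2, ..., 1 F-variables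
   and of the closing edge, which was only compared with the first of these
   minima. This is made precise by integrating over the (n - 1)! relabellings of
   the cities, exactly one of which turns the NN tour into 1, 2, ..., n; by
   symmetry all of them contribute the same iterated integral. The second
   moments of the minima have a finite sum: near 0 the cdf of F is of order
   t^(alpha + 1), so the sum is at most of order E[L^2 / F(L)^2], finite because
   alpha < 1. By Chebyshev's inequality and the uniform continuity of the cdf of
   F, which smooths the law through the closing edge, the cdfs of the centred
   lengths are uniformly Cauchy; their uniform limit is again a cdf. *)

Set Implicit Arguments.
Unset Strict Implicit.
Unset Printing Implicit Defensive.

Import Order.TTheory GRing.Theory Num.Theory.
Import numFieldNormedType.Exports.

Local Open Scope classical_set_scope.
Local Open Scope ring_scope.

Section image_measure.
Context d d' (T : measurableType d) (T' : measurableType d') (R : realType).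
Variables (Q : {finite_measure set T -> \bar R}) (f : {mfun T >-> T'}).

Definition image_measure := pushforward Q f.

Let image0 : image_measure set0 = 0%E.
Proof. by rewrite /image_measure /pushforward preimage_set0 measure0. Qed.

Let image_ge0 A : (0 <= image_measure A)%E.
Proof. exact: measure_ge0. Qed.

Let image_sigma_additive : semi_sigma_additive image_measure.
Proof. exact: (@measure_semi_sigma_additive _ _ _ (pushforward Q f)). Qed.

HB.instance Definition _ := isMeasure.Build _ _ _ image_measure
  image0 image_ge0 image_sigma_additive.

Let image_fin : fin_num_fun image_measure.
Proof.
by move=> A mA; rewrite /image_measure /pushforward fin_num_measure//; exact: measurable_funPTI.
Qed.

HB.instance Definition _ := Measure_isFinite.Build _ _ _ image_measure image_fin.

End image_measure.

Section iterated_integral.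
Context (R : realType) (F : probability (measurableTypeR R) R) (I : eqType).
Local Open Scope ereal_scope.

Definition update (a : I -> R) (e : I) (x : R) : I -> R :=
  fun i => if i == e then x else a i.

Definition splice (s : seq I) (a b : I -> R) : I -> R :=
  fun i => if i \in s then b i else a i.

Fixpoint iter_int (s : seq I) (h : (I -> R) -> \bar R) (a : I -> R) : \bar R :=
  if s is e :: s' then \int[F]_x iter_int s' h (update a e x) else h a.

Definition coord_measurable (h : (I -> R) -> \bar R) :=
  forall d (Y : measurableType d) (X : Y -> I -> measurableTypeR R),
    (forall i, measurable_fun setT (X ^~ i)) ->
    measurable_fun setT (h \o X).

Lemma iter_int_ge0 s h a : (forall a, 0 <= h a) -> 0 <= iter_int s h a.
Proof. by move=> h0; elim: s a => //= e s IH a; exact: integral_ge0. Qed.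

Lemma coord_measurable_iter_int s h : coord_measurable h ->
  (forall a, 0 <= h a) -> coord_measurable (iter_int s h).
Proof.
move=> mh h0; elim: s => //= e s IH d Y X mX.
apply: (@measurable_fun_fubini_tonelli_F _ _ Y (measurableTypeR R) R F
  (fun p => iter_int s h (update (X p.1) e p.2))).
  apply: (IH _ _ (fun p : Y * measurableTypeR R => update (X p.1) e p.2)) => i.
  rewrite /update; have [_|_] := eqVneq i e; first exact: measurable_snd.
  exact: (measurableT_comp (mX i) measurable_fst).
by move=> p; exact: iter_int_ge0.
Qed.

Lemma independent_integral (s : seq I) : uniq s ->
  forall d (T : measurableType d) (Q : {finite_measure set T -> \bar R})
    (X : T -> I -> measurableTypeR R),
  (forall i, measurable_fun setT (X ^~ i)) ->
  (forall B : I -> set (measurableTypeR R), (forall i, measurable (B i)) ->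
     Q [set w | forall i, i \in s -> B i (X w i)] =
     Q setT * \prod_(i <- s) F (B i)) ->
  forall h, coord_measurable h -> (forall a, 0 <= h a) ->
  forall a, \int[Q]_w h (splice s a (X w)) = Q setT * iter_int s h a.
Proof.
elim: s => [_ d T Q X mX XB h mh h0 a|e s IH /= /andP[es us] d T Q X mX XB h mh h0 a].
  by rewrite /splice /= integral_cst// muleC.
pose N := size s.
pose tup (b : I -> measurableTypeR R) : N.-tuple (measurableTypeR R) :=
  [tuple b (tnth (in_tuple s) i) | i < N].
have mtup d' (Y : measurableType d') (Z : Y -> I -> measurableTypeR R) :
    (forall i, measurable_fun setT (Z ^~ i)) ->
    measurable_fun setT (fun y => tup (Z y)).
  move=> mZ; apply/measurable_fun_tnthP => i.
  rewrite (_ : _ \o _ = Z ^~ (tnth (in_tuple s) i)) //.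
  by apply/funext => y /=; rewrite tnth_mktuple.
pose asg (t : N.-tuple (measurableTypeR R)) (i : I) : measurableTypeR R :=
  nth 0%R t (index i s).
have masg i : i \in s -> measurable_fun setT (asg ^~ i).
  move=> si; have iN : (index i s < N)%N by rewrite index_mem.
  rewrite (_ : asg ^~ i = @tnth _ _ ^~ (Ordinal iN)); first exact: measurable_tnth.
  by apply/funext => t; rewrite /asg (tnth_nth 0%R).
have asgK b i : i \in s -> asg (tup b) i = b i.
  move=> si; have iN : (index i s < N)%N by rewrite index_mem.
  rewrite /asg -(tnth_nth 0%R _ (Ordinal iN)) tnth_mktuple.
  by rewrite (tnth_nth i)/= nth_index.
pose h' (p : measurableTypeR R * N.-tuple (measurableTypeR R)) : \bar R :=
  h (splice s (update a e p.1) (asg p.2)).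
have mh' : measurable_fun setT h'.
  apply: (mh _ _ (fun p => splice s (update a e p.1) (asg p.2))) => i.
  rewrite /splice; have [si|_] := boolP (i \in s).
    exact: (measurableT_comp (masg _ si) measurable_snd).
  by rewrite /update; have [_|_] := eqVneq i e; [exact: measurable_fst|].
have mX' : measurable_fun setT (fun w => tup (X w)) by exact: mtup.
pose tX : {mfun T >-> _} :=
  HB.pack (fun w => tup (X w)) (isMeasurableFun.Build _ _ _ _ _ mX').
pose Q' := image_measure Q tX.
have mpair : measurable_fun setT (fun w => (X w e, tup (X w))).
  by apply/measurable_fun_pair.
pose pX : {mfun T >-> _} :=
  HB.pack (fun w => (X w e, tup (X w))) (isMeasurableFun.Build _ _ _ _ _ mpair).
have XBA A B : measurable A -> (forall i, measurable (B i)) ->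
    Q [set w | A (X w e) /\ forall i, i \in s -> B i (X w i)] =
    Q setT * (F A * \prod_(i <- s) F (B i)).
  move=> mA mB; pose B' i := if i == e then A else B i.
  have /XB : forall i, measurable (B' i) by move=> i; rewrite /B'; case: ifP.
  rewrite big_cons {2}/B' eqxx => QB'.
  have -> : \prod_(i <- s) F (B i) = \prod_(i <- s) F (B' i).
    rewrite big_seq [RHS]big_seq; apply: eq_bigr => i si; rewrite /B'.
    by case: eqP => // ie; rewrite -ie si in es.
  rewrite -QB'; congr (Q _); apply/seteqP; split => w /=.
    case=> Aw Bw i; rewrite inE /B' => /orP[/eqP -> |si]; first by rewrite eqxx.
    by case: eqP => [->//|_]; exact: Bw.
  move=> Bw; split=> [|i si]; first by have := Bw e; rewrite /B' mem_head eqxx; apply.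
  have := Bw i; rewrite /B' inE si orbT; case: eqP => [ie|_]; last by apply.
  by rewrite -ie si in es.
have box A C : measurable A -> measurable C ->
    image_measure Q pX (A `*` C) = F A * Q' C.
  move=> mA mC.
  pose EA := [set w | A (X w e)].
  have mEA : measurable EA by rewrite -[EA]setTI; exact: mX.
  have EAoo : Q EA < +oo by rewrite ltey_eq fin_num_measure.
  pose hC (b : I -> measurableTypeR R) : \bar R := (\1_C (tup b))%:E.
  have mhC : coord_measurable hC.
    move=> d' Y Z mZ; apply/measurable_EFinP.
    by apply: (measurableT_comp (measurable_indic _)) => //; exact: mtup.
  have hC0 b : 0 <= hC b by rewrite lee_fin.
  have hCE (Q0 : {finite_measure set T -> \bar R}) :
      \int[Q0]_w hC (splice s a (X w)) = Q0 (tX @^-1` C).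
    rewrite -[X in Q0 X]setIT -integral_indic//; last exact: measurable_funPTI.
    apply: eq_integral => w _; rewrite /hC /= !indicE.
    congr (_%:E); congr ((nat_of_bool _)%:R).
    rewrite (_ : tup (splice s a (X w)) = tX w); first by apply/idP/idP; rewrite !inE.
    apply/val_inj => /=; apply: eq_map => i.
    by rewrite /splice mem_tnth.
  have QC : Q (tX @^-1` C) = Q setT * iter_int s hC a.
    rewrite -hCE (IH us _ _ Q X) // => B mB.
    have := XBA setT B measurableT mB; rewrite probability_setT mul1e => <-.
    by congr (Q _); apply/seteqP; split => w /=; tauto.
  have QAC : mfrestr mEA EAoo (tX @^-1` C) = Q setT * F A * iter_int s hC a.
    rewrite -hCE (IH us _ _ _ X) //.
      congr (_ * _); rewrite /= /mfrestr /mrestr setTI.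
      have := XBA A (fun=> setT) mA (fun=> measurableT).
      rewrite big1; last by move=> *; exact: probability_setT.
      rewrite mule1 => <-; congr (Q _).
      by apply/seteqP; split => w /=; tauto.
    move=> B mB; rewrite /= /mfrestr /mrestr setTI.
    have := XBA A B mA mB.
    have := XBA A (fun=> setT) mA (fun=> measurableT).
    rewrite [X in _ * (_ * X)]big1; last by move=> *; exact: probability_setT.
    rewrite mule1 muleA => <- QAB.
    rewrite (_ : EA = [set w | A (X w e) /\ (forall i, i \in s -> setT (X w i))]); last first.
      by apply/seteqP; split => w /=; tauto.
    rewrite -QAB; congr (Q _); apply/seteqP; split => w /=; tauto.
  transitivity (mfrestr mEA EAoo (tX @^-1` C)).
    by rewrite /mfrestr /mrestr setIC.
  by rewrite QAC /Q' /image_measure /pushforward QC muleCA muleA.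
transitivity (\int[image_measure Q pX]_p h' p).
  rewrite ge0_integral_pushforward//; last by move=> ? _; exact: h0.
  apply: eq_integral => w _ /=; congr h; apply/funext => i.
  rewrite /h' /splice /update /= inE; case: (eqVneq i e) => [-> | ie] /=.
    by rewrite (negbTE es).
  by case: ifPn => // si; rewrite asgK.
transitivity (\int[F \x Q']_p h' p).
  by apply: eq_measure_integral => A mA _; apply/esym/product_measure_unique.
rewrite fubini_tonelli1//; last by move=> p; exact: h0.
have mup i : measurable_fun setT (fun x : measurableTypeR R => update a e x i : measurableTypeR R).
  by rewrite /update; have [_|_] := eqVneq i e.
have mJ : measurable_fun setT (fun x : measurableTypeR R => iter_int s h (update a e x)).
  have := coord_measurable_iter_int s mh h0 mup; exact.
rewrite -ge0_integralZl//; last by move=> x _; exact: iter_int_ge0.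
apply: eq_integral => x _; rewrite /fubini_F.
rewrite /Q' /image_measure ge0_integral_pushforward//=; last 2 first.
- exact: (measurableT_comp mh').
- by move=> ? _; exact: h0.
rewrite -(IH us _ _ Q X)//.
  apply: eq_integral => w _ /=; rewrite /h' /=; congr h; apply/funext => i.
  by rewrite /splice; case: ifPn => // si; rewrite asgK.
move=> B mB.
have := XBA setT B measurableT mB; rewrite probability_setT mul1e => <-.
by congr (Q _); apply/seteqP; split => w /=; tauto.
Qed.

End iterated_integral.

Section real_line_measures.
Context (R : realType).
Implicit Types (g : R -> R) (a b x y e : R).

Lemma continuous_uniform_itv g a b (d : R) : continuous g -> 0 < d ->
  exists2 e, 0 < e & forall x y, a <= x <= b -> `|x - y| < e -> `|g x - g y| < d.
Proof.
move=> cg d0.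
have d20 : 0 < d / 2 by rewrite divr_gt0.
have /compact_near_coveringP/(_ R 0^'+
    (fun e x => forall y, `|x - y| < e -> `|g x - g y| < d) _) := @segment_compact R a b.
case=> [x _|e /= e0 He].
  have /cvgrPdist_lt /(_ (d / 2) d20) := cg x.
  case=> e /= e0 He; have e20 : 0 < e / 2 by rewrite divr_gt0.
  exists (ball x (e / 2), [set i | i < e / 2]) => /=.
    by split; [exact: nbhsx_ballx|exact: nbhs_right_lt].
  case=> x' i /= [xx' ie] y x'y.
  have gx' : `|g x - g x'| < d / 2.
    by apply: He => /=; apply: lt_trans xx' _; rewrite ltr_pdivrMr// ltr_pMr// ltr1n.
  have gy : `|g x - g y| < d / 2.
    apply: He => /=; rewrite -(subrKA x') (le_lt_trans (ler_normD _ _))// (splitr e) ltrD//.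
    exact: lt_trans ie.
  rewrite -(subrKA (g x)) (le_lt_trans (ler_normD _ _))// (splitr d) ltrD//.
  by rewrite distrC.
have e20 : 0 < e / 2 by rewrite divr_gt0.
exists (e / 2) => // x y xab xy; apply: (He (e / 2) _ _ x) => //=.
by rewrite sub0r normrN gtr0_norm// ltr_pdivrMr// ltr_pMr// ltr1n.
Qed.

Definition step_fun g a e (K : nat) y :=
  \sum_(j < K) g (a + j%:R * e) * \1_(`]a + j%:R * e, a + j.+1%:R * e]%classic) y.

Lemma step_fun_approx g (M d a e : R) (K : nat) : 0 < e -> 0 <= d ->
  (forall x, `|g x| <= M) ->
  (forall x y, a <= x <= a + K%:R * e -> `|x - y| <= e -> `|g x - g y| <= d) ->
  forall y, `|g y - step_fun g a e K y| <=
     d + M * (1 - \1_(`]a, a + K%:R * e]%classic) y).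
Proof.
move=> e0 d0 gM nnmeas y.
have M0 : 0 <= M by apply: le_trans (gM 0).
suff: (~ a < y <= a + K%:R * e -> step_fun g a e K y = 0) /\
      (a < y <= a + K%:R * e -> `|g y - step_fun g a e K y| <= d).
  case=> h0 h1; rewrite indicE; have [yI|yI] := boolP (y \in _).
    by rewrite subrr mulr0 addr0 h1//; move: yI; rewrite inE /= in_itv.
  rewrite subr0 mulr1 h0; first by rewrite subr0 (le_trans (gM y))// lerDr.
  by move=> yI'; move/negP: yI; apply; rewrite inE /= in_itv.
elim: K nnmeas => [|K IH] nnmeas.
  rewrite /step_fun big_ord0 mul0r addr0; split=> // /andP[ay ya].
  by have := lt_le_trans ay ya; rewrite ltxx.
have Kle : a + K%:R * e <= a + K.+1%:R * e.
  by rewrite lerD2l ler_wpM2r ?ler_nat// ltW.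
have [|IH0 IH1] := IH.
  by move=> x z /andP[ax xK]; apply: nnmeas; rewrite ax (le_trans xK).
rewrite /step_fun big_ord_recr /= -/(step_fun g a e K y) indicE.
split=> yI.
  rewrite IH0; last first.
    by move=> /andP[ay yK]; apply: yI; rewrite ay (le_trans yK).
  rewrite memNset ?mulr0 ?addr0//= in_itv /= => /andP[Ky yK]; apply: yI.
  by rewrite yK andbT (le_lt_trans _ Ky)// lerDl mulr_ge0// ltW.
case/andP: yI => ay yK; have [yK'|yK'] := leP y (a + K%:R * e).
  rewrite memNset ?mulr0 ?addr0//=; first by rewrite IH1// ay.
  by rewrite in_itv /= ltNge yK'.
rewrite IH0 ?add0r; last by rewrite leNgt yK' andbF.
rewrite mem_set ?mulr1//=; last by rewrite in_itv /= yK' yK.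
rewrite distrC; apply: nnmeas.
  by rewrite Kle andbT lerDl mulr_ge0// ltW.
rewrite distrC ger0_norm; last by rewrite subr_ge0 ltW.
rewrite lerBlDl (le_trans yK)//.
by rewrite -natr1 mulrDl mul1r addrA.
Qed.

Lemma measurable_step_fun g a e K :
  measurable_fun [set: measurableTypeR R] (step_fun g a e K).
Proof.
by apply: measurable_sum => j; apply: measurable_funM.
Qed.

Definition mcdf (nu : probability (measurableTypeR R) R) x := fine (nu `]-oo, x]%classic).

Lemma mcdf_itv (nu : probability (measurableTypeR R) R) a b : a <= b ->
  fine (nu `]a, b]%classic) = mcdf nu b - mcdf nu a.
Proof.
move=> ab.
have -> : `]a, b]%classic = `]-oo, b] `\` `]-oo, a] => [|].
  by rewrite -[RHS]setCK setCD setCitvl setUC -[LHS]setCK setCitv.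
rewrite measureD//= ?setIidr//; last first.
- by rewrite ltey_eq fin_num_measure.
- exact: subset_itvl.
by rewrite fineB// fin_num_measure.
Qed.

Lemma bounded_integrable (nu : probability (measurableTypeR R) R) (g : measurableTypeR R -> R) M :
  measurable_fun setT g -> (forall x, `|g x| <= M) -> nu.-integrable setT (EFin \o g).
Proof.
move=> mg gM; apply: measurable_bounded_integrable => //.
  by rewrite ltey_eq fin_num_measure.
exists M; split=> [|x Mx y _]; first exact: num_real.
exact: le_trans (gM y) (ltW Mx).
Qed.

Lemma Rintegral_step_fun (nu : probability (measurableTypeR R) R) g a e K : 0 < e ->
  (\int[nu]_y step_fun g a e K y =
  \sum_(j < K) g (a + j%:R * e) *
    (mcdf nu (a + j.+1%:R * e) - mcdf nu (a + j%:R * e)))%R.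
Proof.
move=> e0.
suff [] : nu.-integrable setT (EFin \o step_fun g a e K) /\
  (\int[nu]_y step_fun g a e K y = \sum_(j < K) g (a + j%:R * e) *
    (mcdf nu (a + j.+1%:R * e) - mcdf nu (a + j%:R * e)))%R by [].
elim: K => [|K [IHi IH]].
  rewrite (_ : step_fun _ _ _ _ = cst 0); last by apply/funext => y; rewrite /step_fun big_ord0.
  rewrite big_ord0 Rintegral_cst// mul0r; split=> //.
  exact: finite_measure_integrable_cst.
have -> : step_fun g a e K.+1 = fun y => step_fun g a e K y +
    g (a + K%:R * e) * \1_(`]a + K%:R * e, a + K.+1%:R * e]%classic) y.
  by apply/funext => y; rewrite /step_fun big_ord_recr.
have ii : nu.-integrable setT (EFin \o (\1_(`]a + K%:R * e, a + K.+1%:R * e]%classic) : measurableTypeR R -> R)).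
  by apply: integrable_indic => //; rewrite ltey_eq fin_num_measure.
have ig : nu.-integrable setT (EFin \o (fun y => g (a + K%:R * e) * \1_(`]a + K%:R * e, a + K.+1%:R * e]%classic) y)).
  apply: eq_integrable (integrableZl measurableT (g (a + K%:R * e)) ii) => //.
split.
  apply: eq_integrable (integrableD measurableT IHi ig) => //.
rewrite RintegralD// IH big_ord_recr /= RintegralZl//.
congr (_ + _ * _); rewrite -mcdf_itv; last first.
  by rewrite lerD2l ler_wpM2r ?ler_nat// ltW.
by rewrite /Rintegral integral_indic// setIT.
Qed.

Lemma integral_step_approx (nu : probability (measurableTypeR R) R) g (M d a e : R) (K : nat) :
  continuous g -> 0 < e -> 0 <= d -> (forall x, `|g x| <= M) ->
  (forall x y, a <= x <= a + K%:R * e -> `|x - y| <= e -> `|g x - g y| <= d) ->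
  `| \int[nu]_y g y - \sum_(j < K) g (a + j%:R * e) *
    (mcdf nu (a + j.+1%:R * e) - mcdf nu (a + j%:R * e)) |%R <=
   d + M * (1 - (mcdf nu (a + K%:R * e) - mcdf nu a)).
Proof.
move=> cg e0 d0 gM nnmeas.
have M0 : 0 <= M by apply: le_trans (gM 0).
have mg : measurable_fun [set: measurableTypeR R] g by exact: continuous_measurable_fun.
have ig := bounded_integrable nu mg gM.
have ih : nu.-integrable setT (EFin \o step_fun g a e K).
  apply: (@bounded_integrable _ _ (M + (d + M))); first exact: measurable_step_fun.
  move=> y; rewrite -[step_fun _ _ _ _ _](subKr (g y)).
  apply: (le_trans (ler_normB _ _)); rewrite lerD// (le_trans (step_fun_approx e0 d0 gM nnmeas y))//.
  by rewrite lerD2l ler_piMr// lerBlDr lerDl.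
have iI : nu.-integrable setT (EFin \o (fun y : measurableTypeR R => d + M * (1 - \1_(`]a, a + K%:R * e]%classic) y))).
  apply: (@bounded_integrable _ _ (d + M)).
    apply: measurable_funD => //; apply: measurable_funM => //.
    by apply: measurable_funB => //; exact: measurable_indic.
  move=> y; rewrite ger0_norm; first by rewrite lerD2l ler_piMr// lerBlDr lerDl.
  by rewrite addr_ge0// mulr_ge0// indicE; case: (_ \in _); rewrite ?subr0// subrr.
have igh : nu.-integrable setT (EFin \o (fun y => g y - step_fun g a e K y)).
  by apply: eq_integrable (integrableB measurableT ig ih).
rewrite -Rintegral_step_fun// -RintegralB//.
apply: (le_trans (le_normr_Rintegral _ _)) => //.
apply: (@le_trans _ _ (\int[nu]_y (d + M * (1 - \1_(`]a, a + K%:R * e]%classic) y)))%R).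
  apply: le_Rintegral => //.
    exact: (integrable_norm igh).
  by move=> y _; exact: step_fun_approx.
have icst c : nu.-integrable setT (EFin \o (fun _ : measurableTypeR R => c)).
  exact: finite_measure_integrable_cst.
have ii : nu.-integrable setT (EFin \o (\1_(`]a, a + K%:R * e]%classic) : measurableTypeR R -> R)).
  by apply: integrable_indic => //; rewrite ltey_eq fin_num_measure.
have iB : nu.-integrable setT (EFin \o (fun y : measurableTypeR R => 1 - \1_(`]a, a + K%:R * e]%classic) y)).
  apply: eq_integrable (integrableB measurableT (icst 1) ii) => //.
have iM : nu.-integrable setT (EFin \o (fun y : measurableTypeR R => M * (1 - \1_(`]a, a + K%:R * e]%classic) y))).
  apply: eq_integrable (integrableZl measurableT M iB) => //.
rewrite RintegralD// RintegralZl// RintegralB// !Rintegral_cst//.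
rewrite (_ : fine _ = 1); last by rewrite [X in fine X](@probability_setT _ _ _ nu).
rewrite !mulr1 -mcdf_itv; last by rewrite lerDl mulr_ge0// ltW.
by rewrite [X in _ - X]/Rintegral integral_indic// setIT.
Qed.

Let measurable_idTR : measurable_fun setT (idfun : measurableTypeR R -> R).
Proof. by move=> _ Y mY; rewrite setTI. Qed.

Let idTR (nu : probability (measurableTypeR R) R) : {RV nu >-> R} :=
  HB.pack (idfun : measurableTypeR R -> R)
    (isMeasurableFun.Build _ _ _ _ _ measurable_idTR).

Lemma cvg_mcdf_y (nu : probability (measurableTypeR R) R) : mcdf nu @ +oo --> (1 : R).
Proof. exact/fine_cvg/(cvg_cdfy1 (idTR nu)). Qed.

Lemma cvg_mcdf_Ny (nu : probability (measurableTypeR R) R) : mcdf nu @ -oo --> (0 : R).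
Proof. exact/fine_cvg/(cvg_cdfNy0 (idTR nu)). Qed.

Lemma mcdf_right_continuous (nu : probability (measurableTypeR R) R) :
  right_continuous (mcdf nu).
Proof.
move=> a; apply: fine_cvg; rewrite /mcdf fineK ?fin_num_measure//.
exact: (cdf_right_continuous (X := idTR nu)).
Qed.

Lemma mcdf_nondecreasing (nu : probability (measurableTypeR R) R) :
  nondecreasing (mcdf nu).
Proof.
by move=> x y xy; rewrite fine_le ?fin_num_measure// le_measure ?inE//; exact: subitvPr.
Qed.

End real_line_measures.

Section weak_convergence.
Context (R : realType) (d : nat -> measure_display) (T : forall n, measurableType (d n)).
Context (P : forall n, probability (T n) R) (X : forall n, {RV (P n) >-> measurableTypeR R}).

Let nu n : probability (measurableTypeR R) R := distribution (P n) (X n).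

Lemma weak_limit_of_uniform_cvg_cdf (mu : probability (measurableTypeR R) R) :
  (forall e, 0 < e -> \forall n \near \oo, forall x, `|mcdf (nu n) x - mcdf mu x| <= e) ->
  converges_weakly_to P (fun n => X n : T n -> R) mu.
Proof.
move=> Hu g cg [M gM].
have M0 : 0 <= M by apply: le_trans (gM 0).
have mg : measurable_fun [set: measurableTypeR R] g by exact: continuous_measurable_fun.
have ig rho := bounded_integrable rho mg gM.
suff gcvg : (\int[nu n]_y g y)%R @[n --> \oo] --> (\int[mu]_y g y)%R.
  have -> : (fun n => 'E_(P n)[g \o X n])%E = fun n => ((\int[nu n]_y g y)%R)%:E.
    apply/funext => n; rewrite unlock fineK; last by apply: integrable_fin_num => //; exact: ig.
    rewrite [RHS]integral_distribution//; first exact/measurable_EFinP.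
    apply: measurable_bounded_integrable => //.
      by rewrite ltey_eq fin_num_measure.
      exact: (measurableT_comp mg).
    exists M; split=> [|x Mx y _]; first exact: num_real.
    exact: le_trans (gM _) (ltW Mx).
  rewrite -[X in _ --> X]fineK; last by apply: integrable_fin_num => //; exact: ig.
  by apply: cvg_EFin => //; near=> n.
apply/cvgrPdist_le => eps eps0.
pose q := eps / (16 * (M + 1)).
have M1 : 0 < M + 1 by rewrite ltr_pwDr.
have q0 : 0 < q by rewrite divr_gt0// mulr_gt0.
have Mq : M * q <= eps / 16.
  rewrite (_ : M * q = eps / 16 * (M / (M + 1))); last by rewrite /q; field; rewrite gt_eqF.
  by rewrite ler_piMr ?divr_ge0 ?(ltW eps0)// ler_pdivrMr// mul1r lerDl.
have [a Ha] : exists a, mcdf mu a <= q.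
  have /cvgrPdist_le/(_ _ q0) := @cvg_mcdf_Ny R mu.
  case=> z [_ Hz]; exists (z - 1); have := Hz (z - 1).
  by rewrite sub0r normrN ltrBlDr ltrDl => /(_ ltr01); exact: le_trans (ler_norm _).
have [b [ab Hb]] : exists b, a < b /\ 1 - mcdf mu b <= q.
  have /cvgrPdist_le/(_ _ q0) := @cvg_mcdf_y R mu.
  case=> z [_ Hz]; exists (Num.max a z + 1); split.
    by rewrite (@le_lt_trans _ _ (Num.max a z)) ?le_max ?lexx// ltrDl.
  apply: le_trans (ler_norm _) _; apply: Hz.
  by rewrite (@le_lt_trans _ _ (Num.max a z)) ?le_max ?lexx ?orbT// ltrDl.
have eps8 : 0 < eps / 8 by rewrite divr_gt0.
have [e0 e00 ge] := @continuous_uniform_itv _ g a b (eps / 8) cg eps8.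
pose K := (Num.truncn ((b - a) / e0)).+1.
have K0 : 0 < K%:R :> R by rewrite ltr0n.
pose e := (b - a) / K%:R.
have e_gt0 : 0 < e by rewrite divr_gt0// subr_gt0.
have ee0 : e < e0.
  by rewrite ltr_pdivrMr// mulrC -ltr_pdivrMr// Num.Theory.truncnS_gt.
have Kb : a + K%:R * e = b by rewrite /e mulrC divfK ?gt_eqF// subrKC.
have nnmeas x y : a <= x <= a + K%:R * e -> `|x - y| <= e -> `|g x - g y| <= eps / 8.
  by rewrite Kb => xab xy; apply/ltW/ge => //; exact: le_lt_trans ee0.
have approx rho := integral_step_approx rho cg e_gt0 (ltW eps8) gM nnmeas.
pose r := Num.min q (eps / (16 * (M + 1) * K%:R)).
have r0 : 0 < r by rewrite lt_min q0 divr_gt0// !mulr_gt0.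
have Mr : M * r <= eps / 16.
  by apply: le_trans Mq; rewrite ler_wpM2l// ge_min lexx.
have MKr : M * K%:R * r <= eps / 16.
  apply: (@le_trans _ _ (M * K%:R * (eps / (16 * (M + 1) * K%:R)))).
    by rewrite ler_wpM2l ?mulr_ge0// ge_min lexx orbT.
  rewrite (_ : _ * _ = M * q) // /q.
  by field; rewrite !gt_eqF.
have := Hu r r0; apply: filterS => n Hn.
have := approx mu; have := approx (nu n); rewrite Kb.
set Sn := \sum_(j < K) _; set Sm := \sum_(j < K) _.
set In := (\int[nu n]_y g y)%R; set Im := (\int[mu]_y g y)%R => Bn Bm.
have SS : `|Sm - Sn| <= 2 * (M * K%:R * r).
  rewrite /Sm /Sn -sumrB; apply: (le_trans (ler_norm_sum _ _ _)).
  apply: (@le_trans _ _ (\sum_(j < K) (M * (2 * r)))).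
    apply: ler_sum => j _; rewrite -mulrBr normrM ler_pM//.
    have := Hn (a + j.+1%:R * e); have := Hn (a + j%:R * e).
    rewrite !ler_norml => /andP[? ?] /andP[? ?]; apply/andP; split; lra.
  by rewrite sumr_const card_ord -[leLHS]mulr_natl le_eqVlt; apply/orP; left; apply/eqP; ring.
have Ga : mcdf mu a >= 0 by rewrite fine_ge0.
have := Hn a; have := Hn b; rewrite !ler_norml => /andP[Hb1 Hb2] /andP[Ha1 Ha2].
have C1 : M * (1 - (mcdf mu b - mcdf mu a)) <= eps / 8.
  apply: (@le_trans _ _ (M * (2 * q))); first by rewrite ler_wpM2l//; lra.
  lra.
have C2 : M * (1 - (mcdf (nu n) b - mcdf (nu n) a)) <= eps / 4.
  apply: (@le_trans _ _ (M * (2 * q + 2 * r))); first by rewrite ler_wpM2l//; lra.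
  rewrite (_ : _ * _ = 2 * (M * q) + 2 * (M * r)); last by ring.
  lra.
move: Bn Bm SS; rewrite !ler_norml => /andP[? ?] /andP[? ?] /andP[? ?].
apply/andP; split; lra.
Unshelve. all: by end_near. Qed.

Lemma weak_limit_of_uniform_cauchy_cdf :
  (forall e, 0 < e -> exists N, forall m n, (N <= m)%N -> (N <= n)%N ->
     forall x, mcdf (nu m) x <= mcdf (nu n) x + e) ->
  exists mu, converges_weakly_to P (fun n => X n : T n -> R) mu.
Proof.
move=> HC.
have HC' e : 0 < e -> exists N, forall m n, (N <= m)%N -> (N <= n)%N ->
     forall x, `|mcdf (nu m) x - mcdf (nu n) x| <= e.
  move=> /HC[N HN]; exists N => m n Nm Nn x.
  by have := HN m n Nm Nn x; have := HN n m Nn Nm x; rewrite ler_norml => ? ?; apply/andP; split; lra.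
pose G x := limn (fun n => mcdf (nu n) x).
have Gcvg x : mcdf (nu n) x @[n --> \oo] --> G x.
  apply/cauchy_cvgP/cauchyP => e e0; have e20 : 0 < e / 2 by rewrite divr_gt0.
  have [N HN] := HC' _ e20; exists (mcdf (nu N) x), N => // n /= Nn.
  apply: le_lt_trans (HN _ _ (leqnn N) Nn x) _.
  by rewrite ltr_pdivrMr// ltr_pMr// ltr1n.
have Gunif e : 0 < e -> \forall n \near \oo, forall x, `|mcdf (nu n) x - G x| <= e.
  move=> /HC'[N HN]; exists N => // n /= Nn x.
  have GN : \forall m \near \oo, `|mcdf (nu n) x - mcdf (nu m) x| <= e.
    by exists N => // m /= Nm; exact: HN.
  apply: (cvgr_to_le _ GN); apply: cvg_norm; apply: cvgB (Gcvg x); exact: cvg_cst.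
have Gnd : nondecreasing G.
  move=> x y xy; apply: ler_cvg_to (Gcvg x) (Gcvg y) _.
  by near=> n; exact: mcdf_nondecreasing.
have Grc : right_continuous G.
  move=> a; apply/cvgrPdist_le => e e0; have e30 : 0 < e / 3 by rewrite divr_gt0.
  have [N _ HN] := Gunif _ e30; have {}HN := HN N (leqnn N).
  have /cvgrPdist_le/(_ _ e30) := @mcdf_right_continuous R (nu N) a.
  apply: filterS => x; have := HN x; have := HN a; rewrite !ler_norml.
  move=> /andP[? ?] /andP[? ?] /andP[? ?]; apply/andP; split; lra.
have GNy : G @ -oo --> (0 : R).
  apply/cvgrPdist_le => e e0; have e20 : 0 < e / 2 by rewrite divr_gt0.
  have [N _ HN] := Gunif _ e20; have {}HN := HN N (leqnn N).
  have /cvgrPdist_le/(_ _ e20) := @cvg_mcdf_Ny R (nu N).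
  apply: filterS => x; have := HN x; rewrite !ler_norml.
  move=> /andP[? ?] /andP[? ?]; apply/andP; split; lra.
have Gy : G @ +oo --> (1 : R).
  apply/cvgrPdist_le => e e0; have e20 : 0 < e / 2 by rewrite divr_gt0.
  have [N _ HN] := Gunif _ e20; have {}HN := HN N (leqnn N).
  have /cvgrPdist_le/(_ _ e20) := @cvg_mcdf_y R (nu N).
  apply: filterS => x; have := HN x; rewrite !ler_norml.
  move=> /andP[? ?] /andP[? ?]; apply/andP; split; lra.
pose cG : cumulativeBounded (0 : R) (1 : R) :=
  HB.pack G (isCumulative.Build R _ R G Gnd Grc) (isCumulativeBounded.Build R 0 1 G GNy Gy).
pose mu : probability (measurableTypeR R) R := lebesgue_stieltjes_measure cG.
have muG x : mcdf mu x = G x.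
  by rewrite /mcdf [X in fine X](cdf_lebesgue_stieltjes_id cG x).
exists mu; apply: weak_limit_of_uniform_cvg_cdf => e /Gunif.
by apply: filterS => n Hn x; rewrite muG.
Unshelve. all: by end_near. Qed.

End weak_convergence.

Section measurability.
Context d (T : measurableType d) (R : realType).

Lemma measurable_bool_ring (b : T -> bool) : measurable_fun setT b ->
  measurable_fun setT (fun x => (b x)%:R : R).
Proof.
move=> mb; rewrite (_ : (fun _ => _) = fun x => if b x then 1 else 0 : R).
  exact: measurable_fun_ifT.
by apply/funext => x; case: (b x).
Qed.

Lemma measurable_ltrR (f g : T -> R) : measurable_fun setT f -> measurable_fun setT g ->
  measurable_fun setT (fun x => (f x < g x)%R%:R : R).
Proof. by move=> mf mg; apply: measurable_bool_ring; exact: measurable_fun_ltr. Qed.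

Lemma measurable_lerR (f g : T -> R) : measurable_fun setT f -> measurable_fun setT g ->
  measurable_fun setT (fun x => (f x <= g x)%R%:R : R).
Proof. by move=> mf mg; apply: measurable_bool_ring; exact: measurable_fun_ler. Qed.

End measurability.

Lemma indic_ray (R : realType) (x t : R) :
  \1_(`]x, +oo[%classic) t = (x < t)%R%:R :> R.
Proof.
rewrite indicE; congr (nat_of_bool _)%:R.
by apply/idP/idP; rewrite inE /= in_itv /= andbT.
Qed.

Section survival.
Context (R : realType) (F : probability (measurableTypeR R) R).
Local Open Scope ereal_scope.

Definition survival (x : R) : R := fine (F `]x, +oo[%classic).

Lemma survivalE x : (survival x)%:E = F `]x, +oo[%classic.
Proof. by rewrite fineK// fin_num_measure. Qed.

Lemma survival_ge0 x : (0 <= survival x)%R.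
Proof. by rewrite fine_ge0. Qed.

Lemma survival_mcdf x : survival x = (1 - mcdf F x)%R.
Proof.
by rewrite /mcdf /survival -setCitvl probability_setC// fineB ?fin_num_measure.
Qed.

Lemma survival_le1 x : (survival x <= 1)%R.
Proof. by rewrite survival_mcdf lerBlDr lerDl fine_ge0. Qed.

Lemma measurable_survival : measurable_fun [set: measurableTypeR R] survival.
Proof.
apply: nonincreasing_measurable => // x y xy.
by rewrite fine_le ?fin_num_measure// le_measure ?inE//; exact: subitvPl.
Qed.

Lemma measurable_survivalX k :
  measurable_fun [set: measurableTypeR R] (fun x => (survival x ^+ k)%:E).
Proof. by apply/measurable_EFinP; apply: measurable_funX; exact: measurable_survival. Qed.

Lemma survivalX_ge0 k x : (0 <= survival x ^+ k)%R.
Proof. by rewrite exprn_ge0// survival_ge0. Qed.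
Local Hint Resolve survival_ge0 survivalX_ge0 measurable_survivalX : core.

Lemma integral_ray_survivalX k x : (forall t, F [set t] = 0) ->
  \int[F]_(t in `]x, +oo[) (survival t ^+ k)%:E =
  (survival x ^+ k.+1 / k.+1%:R)%:E.
Proof.
move=> F1; elim: k x => [|k IH] x.
  under eq_integral do rewrite expr0.
  by rewrite integral_cst//= mul1e -survivalE expr1 divr1.
have k1 : (k.+1%:R != 0 :> R)%R by rewrite pnatr_eq0.
pose I k x := \int[F]_(t in `]x, +oo[) (survival t ^+ k)%:E.
pose K (p : R * R) : \bar R :=
  ((x < p.1)%R%:R * (p.1 < p.2)%R%:R * survival p.1 ^+ k)%:E.
have msk j : measurable_fun [set: measurableTypeR R] (fun t => survival t ^+ j)%R.
  by apply: measurable_funX; exact: measurable_survival.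
have mray y : measurable_fun [set: measurableTypeR R] (fun t => (y < t)%R%:R : R).
  exact: measurable_ltrR.
have mI j y : measurable_fun [set: measurableTypeR R]
    (fun t => ((y < t)%R%:R * survival t ^+ j)%:E).
  by apply/measurable_EFinP; exact: measurable_funM.
have mK : measurable_fun [set: measurableTypeR R * measurableTypeR R] K.
  apply/measurable_EFinP; apply: measurable_funM; last exact: (measurableT_comp (msk k)).
  apply: measurable_funM; first exact: (measurableT_comp (mray x)).
  exact: measurable_ltrR.
have K0 p : 0 <= K p by rewrite lee_fin !mulr_ge0.
have I0 j y t : 0 <= ((y < t)%R%:R * survival t ^+ j)%:E by rewrite lee_fin mulr_ge0.
have IE j y : I j y = \int[F]_t ((y < t)%R%:R * survival t ^+ j)%:E.
  rewrite /I integral_mkcond; apply: eq_integral => t _.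
  rewrite patchE; case: ifPn => yt.
    by move: yt; rewrite inE /= in_itv /= andbT => ->; rewrite mul1r.
  by move: yt; rewrite notin_setE /= in_itv /= andbT => /negP/negbTE ->; rewrite mul0r.
have SE y : (survival y)%:E = \int[F]_t ((y < t)%R%:R)%:E.
  rewrite survivalE -[X in F X]setIT -integral_indic//; apply: eq_integral => t _.
  by rewrite indic_ray.
have E1 : I k.+1 x = \int[F]_t \int[F]_u K (t, u).
  rewrite IE; apply: eq_integral => t _; rewrite /K /=.
  transitivity (\int[F]_u (((x < t)%R%:R * survival t ^+ k)%:E * ((t < u)%R%:R)%:E)).
    rewrite ge0_integralZl ?lee_fin ?mulr_ge0//; last exact/measurable_EFinP.
    by rewrite -SE -EFinM exprS -mulrA [(survival t * _)%R]mulrC.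
  by apply: eq_integral => u _; rewrite -EFinM mulrAC.
have IE' u : (survival u ^+ k.+1 / k.+1%:R)%:E = I k u by rewrite -IH.
have E3 : \int[F]_u ((x < u)%R%:R * (survival u ^+ k.+1 / k.+1%:R))%:E =
    (k.+1%:R^-1)%:E * I k.+1 x.
  rewrite IE -(ge0_integralZl F measurableT (mI k.+1 x)) ?lee_fin//.
  by apply: eq_integral => u _; rewrite -EFinM mulrA mulrC.
have E2 : I k.+1 x + \int[F]_u ((x < u)%R%:R * (survival u ^+ k.+1 / k.+1%:R))%:E =
    (survival x * (survival x ^+ k.+1 / k.+1%:R))%:E.
  rewrite E1 (@fubini_tonelli _ _ (measurableTypeR R) (measurableTypeR R) R F F K)//.
  rewrite -ge0_integralD//; first last.
  - under eq_fun do rewrite mulrA.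
    by apply/measurable_EFinP; apply: measurable_funM => //; exact: measurable_funM.
  - by move=> u _; rewrite lee_fin mulr_ge0// divr_ge0.
  - exact: measurable_fun_fubini_tonelli_G.
  - by move=> u _; exact: integral_ge0.
  rewrite mulrC EFinM SE -ge0_integralZl ?lee_fin ?divr_ge0//; last exact/measurable_EFinP.
  apply: eq_integral => u _; rewrite /K /=.
  have [xu|xu] := ltP x u.
    rewrite !mul1r mule1 !IE' !IE.
    have mKu : measurable_fun [set: measurableTypeR R] (fun t => K (t, u)).
      rewrite /K /=; apply/measurable_EFinP; apply: measurable_funM (msk k).
      by apply: measurable_funM (mray x) _; exact: measurable_ltrR.
    have Ku0 t : 0 <= K (t, u) by exact: K0.
    rewrite -(ge0_integralD F measurableT (fun t _ => Ku0 t) mKu (fun t _ => I0 k u t) (mI k u)).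
    apply: ge0_ae_eq_integral => //.
    - exact: emeasurable_funD.
    - by move=> t _; exact: adde_ge0.
    exists [set u]; split => //; first exact: F1.
    move=> t /= /not_implyP[_] tu; apply: contrapT => /eqP tu'; apply: tu.
    rewrite /K /= -EFinD -mulrDl; congr (_ * _)%:E.
    have [ut|ut|] := ltgtP u t.
    - by rewrite (lt_trans xu ut) mulr0 add0r.
    - by rewrite mulr1 addr0.
    - by move=> ut; rewrite ut eqxx in tu'.
  rewrite mul0r adde0 mule0; apply: integral0_eq => t _.
  have [xt|xt] := ltP x t; last by rewrite !mul0r.
  by rewrite ltNge (le_trans xu (ltW xt)) mulr0 mul0r.
have Ifin : I k.+1 x \is a fin_num.
  rewrite ge0_fin_numE ?integral_ge0//; last by move=> t _; rewrite lee_fin.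
  apply: (@le_lt_trans _ _ (\int[F]_(t in `]x, +oo[) cst 1%E t)).
    apply: ge0_le_integral => //.
    + by move=> t _; rewrite lee_fin.
    + exact: measurable_funTS.
    + by move=> t _; rewrite lee_fin exprn_ile1// survival_le1.
  by rewrite integral_cst// mul1e ltey_eq fin_num_measure.
move: E2; rewrite E3 -/(I _ _) -(fineK Ifin) -EFinM -EFinD => -[E2].
congr (_%:E).
have k2 : (k.+1%:R + 1 != 0 :> R)%R by rewrite natr1 pnatr_eq0.
apply: (mulIf (x := 1 + k.+1%:R^-1)%R).
  by rewrite gt_eqF// addr_gt0// invr_gt0 ltr0n.
rewrite mulrDr mulr1 [X in (_ + X)%R]mulrC E2 -natr1 [in RHS]exprS.
by field; rewrite natr1 k1 -natrD pnatr_eq0.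
Qed.

Lemma integral_survivalX k : (forall t, F [set t] = 0) -> F [set t | 0 <= t]%R = 1 ->
  \int[F]_t (survival t ^+ k)%:E = (k.+1%:R^-1)%:E.
Proof.
move=> F1 F0.
have FN : F `]-oo, (-1)%R]%classic = 0.
  apply/eqP; rewrite -measure_le0.
  have : F (~` [set t | 0 <= t]%R) = 0.
    rewrite probability_setC ?F0 ?subee//.
    rewrite (_ : [set t | 0 <= t]%R = `[0%R, +oo[%classic)//.
    by apply/seteqP; split => t /=; rewrite in_itv /= andbT.
  move=> <-; apply: le_measure; rewrite ?inE//.
    apply: measurableC; rewrite (_ : [set t | 0 <= t]%R = `[0%R, +oo[%classic)//.
    by apply/seteqP; split => t /=; rewrite in_itv /= andbT.
  by move=> t /=; rewrite in_itv /= => t1; apply/negP; rewrite -ltNge (le_lt_trans t1)// ltrN10.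
rewrite (ge0_negligible_integral _ measurableT _ _ FN)//.
rewrite setTD setCitvl integral_ray_survivalX//.
rewrite survival_mcdf /mcdf FN /= subr0 expr1n div1r//.
by move=> t _; rewrite lee_fin.
Qed.
End survival.

Section minimum_operators.
Context (R : realType) (F : probability (measurableTypeR R) R).
Hypothesis F_atomless : forall t, F [set t] = 0%E.
Hypothesis F_nonneg : F [set t | 0 <= t] = 1%E.
Hypothesis F_square : F.-integrable setT (fun t => (t ^+ 2)%:E).

Local Notation survival := (survival F).

(* The density with respect to F of the minimum of k.+1 independent F-variables. *)
Definition min_weight k x := k.+1%:R * survival x ^+ k.

Lemma min_weight_ge0 k x : 0 <= min_weight k x.
Proof. by rewrite mulr_ge0// exprn_ge0// survival_ge0. Qed.

Lemma min_weight_le k x : min_weight k x <= k.+1%:R.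
Proof. by rewrite ler_piMr// exprn_ile1// ?survival_ge0// survival_le1. Qed.

Lemma measurable_min_weight k : measurable_fun [set: measurableTypeR R] (min_weight k).
Proof.
apply: measurable_funM => //; apply: measurable_funX; exact: measurable_survival.
Qed.
Local Hint Resolve min_weight_ge0 measurable_min_weight : core.

Lemma integral_min_weight k : (\int[F]_x (min_weight k x)%:E = 1)%E.
Proof.
under eq_integral do rewrite EFinM.
rewrite ge0_integralZl//; last 2 first.
- exact: measurable_survivalX.
- by move=> x _; rewrite lee_fin exprn_ge0// survival_ge0.
by rewrite integral_survivalX// -EFinM divff// pnatr_eq0.
Qed.

Definition nnmeas (h : R -> \bar R) := measurable_fun [set: R] h /\ forall y, (0 <= h y)%E.

Definition min_op k (h : R -> \bar R) y := (\int[F]_x ((min_weight k x)%:E * h (y + x)%R))%E.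

Lemma measurable_min_op_integrand k h y : nnmeas h ->
  measurable_fun [set: measurableTypeR R] (fun x => (min_weight k x)%:E * h (y + x)%R)%E.
Proof.
move=> [mh h0]; apply: emeasurable_funM; first exact/measurable_EFinP.
by apply: (measurableT_comp mh); exact: measurable_funD.
Qed.

Lemma min_op_integrand_ge0 k h y x : nnmeas h -> (0 <= (min_weight k x)%:E * h (y + x)%R)%E.
Proof. by move=> [mh h0]; rewrite mule_ge0// lee_fin. Qed.

Lemma nnmeas_min_op k h : nnmeas h -> nnmeas (min_op k h).
Proof.
move=> gh; split; last by move=> y; apply: integral_ge0 => x _; exact: min_op_integrand_ge0.
have [mh h0] := gh.
apply: (@measurable_fun_fubini_tonelli_F _ _ R (measurableTypeR R) R F
  (fun p => (min_weight k p.2)%:E * h (p.1 + p.2)%R)%E).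
  apply: emeasurable_funM.
    by apply/measurable_EFinP; exact: (measurableT_comp (measurable_min_weight k)).
  apply: (measurableT_comp mh).
  by apply: measurable_funD => //; exact: measurable_snd.
by move=> p; exact: min_op_integrand_ge0.
Qed.

Lemma le_min_op k h1 h2 : nnmeas h1 -> nnmeas h2 -> (forall y, (h1 y <= h2 y)%E) ->
  forall y, (min_op k h1 y <= min_op k h2 y)%E.
Proof.
move=> g1 g2 h12 y; apply: ge0_le_integral => //.
- by move=> x _; exact: min_op_integrand_ge0.
- exact: measurable_min_op_integrand.
- exact: measurable_min_op_integrand.
- by move=> x _; rewrite lee_wpmul2l// lee_fin.
Qed.

Lemma min_opD k h1 h2 : nnmeas h1 -> nnmeas h2 ->
  forall y, min_op k (fun y => h1 y + h2 y)%E y = (min_op k h1 y + min_op k h2 y)%E.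
Proof.
move=> g1 g2 y; have [_ p1] := g1; have [_ p2] := g2.
rewrite /min_op -ge0_integralD//.
- by apply: eq_integral => x _; rewrite ge0_muleDr.
- by move=> x _; exact: min_op_integrand_ge0.
- exact: measurable_min_op_integrand.
- by move=> x _; exact: min_op_integrand_ge0.
- exact: measurable_min_op_integrand.
Qed.

Lemma min_op_cst k (c : \bar R) y : (0 <= c)%E -> min_op k (fun=> c) y = c.
Proof.
move=> c0; rewrite /min_op ge0_integralZr//; last 2 first.
- exact/measurable_EFinP.
- by move=> x _; rewrite lee_fin.
by rewrite integral_min_weight mul1e.
Qed.

Lemma integrable_min_weightM k (g : R -> R) : F.-integrable setT (EFin \o g) ->
  F.-integrable setT (EFin \o (fun x => min_weight k x * g x)).
Proof.
move=> ig; have mg : measurable_fun [set: measurableTypeR R] g.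
  by apply/measurable_EFinP; exact: measurable_int ig.
apply: le_integrable (integrableZl measurableT k.+1%:R ig) => //.
  by apply/measurable_EFinP; exact: measurable_funM.
move=> x _; rewrite /= lee_fin (normrM (min_weight k x)) [leRHS]normrM (ger0_norm (min_weight_ge0 _ _)) (ger0_norm (ler0n _ _)).
by rewrite ler_wpM2r// min_weight_le.
Qed.

Lemma integrable_cst_real (c : R) : F.-integrable setT (EFin \o (fun=> c)).
Proof. exact: finite_measure_integrable_cst. Qed.

Lemma integrableD_real (f g : R -> R) : F.-integrable setT (EFin \o f) -> F.-integrable setT (EFin \o g) ->
  F.-integrable setT (EFin \o (fun x => f x + g x)).
Proof. by move=> fi gi; apply: eq_integrable (integrableD measurableT fi gi). Qed.

Lemma integrable_id : F.-integrable setT (EFin \o (fun x : R => x)).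
Proof.
apply: le_integrable (integrableD_real (integrable_cst_real 1) F_square) => //.
  exact/measurable_EFinP.
move=> x _ /=; rewrite lee_fin [leRHS]ger0_norm; last by rewrite addr_ge0// sqr_ge0.
have := sqr_ge0 (`|x| - 1); rewrite -[x ^+ 2]real_normK ?num_real//; nra.
Qed.

Definition min_mean k := (\int[F]_x (min_weight k x * x))%R.
Definition min_square k := (\int[F]_x (min_weight k x * x ^+ 2))%R.
Definition min_var k := (\int[F]_x (min_weight k x * (x - min_mean k) ^+ 2))%R.

Lemma integrable_quadratic a b c :
  F.-integrable setT (EFin \o (fun x => a * x ^+ 2 + b * x + c)).
Proof.
apply: integrableD_real; last exact: integrable_cst_real.
apply: integrableD_real.
  by apply: eq_integrable (integrableZl measurableT a F_square).
by apply: eq_integrable (integrableZl measurableT b integrable_id).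
Qed.

Lemma Rintegral_min_weight_quadratic k a b c :
  (\int[F]_x (min_weight k x * (a * x ^+ 2 + b * x + c)) =
   a * min_square k + b * min_mean k + c)%R.
Proof.
have i2 := integrable_min_weightM k F_square.
have i1 := integrable_min_weightM k integrable_id.
have i0 : F.-integrable setT (EFin \o (fun x => min_weight k x)).
  apply: eq_integrable (integrable_min_weightM k (integrable_cst_real 1)) => // x _ /=.
  by rewrite mulr1.
have iZ (r : R) (g : R -> R) : F.-integrable setT (EFin \o g) ->
    F.-integrable setT (EFin \o (fun x => r * g x)).
  by move=> ig; apply: eq_integrable (integrableZl measurableT r ig).
transitivity (\int[F]_x ((a * (min_weight k x * x ^+ 2) + b * (min_weight k x * x)) +
    c * min_weight k x))%R.
  by apply: eq_Rintegral => x _; ring.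
rewrite RintegralD//; [|by apply: integrableD_real; exact: iZ|exact: iZ].
rewrite RintegralD//; [|exact: iZ|exact: iZ].
have w1 : (\int[F]_x min_weight k x = 1)%R by rewrite /Rintegral integral_min_weight.
by rewrite (RintegralZl a measurableT i2) (RintegralZl b measurableT i1) (RintegralZl c measurableT i0) w1 mulr1.
Qed.

Lemma min_var_square k : min_var k = min_square k - min_mean k ^+ 2.
Proof.
transitivity (\int[F]_x (min_weight k x * (1 * x ^+ 2 + (- 2 * min_mean k) * x + min_mean k ^+ 2)))%R.
  by apply: eq_Rintegral => x _; ring.
rewrite Rintegral_min_weight_quadratic; ring.
Qed.

Lemma min_var_ge0 k : 0 <= min_var k.
Proof. by apply: Rintegral_ge0 => x _; rewrite mulr_ge0// sqr_ge0. Qed.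

Lemma min_var_le k : min_var k <= min_square k.
Proof. by rewrite min_var_square lerBlDr lerDl sqr_ge0. Qed.

Lemma min_mean_le k : min_mean k ^+ 2 <= min_square k.
Proof. by rewrite -subr_ge0 -min_var_square min_var_ge0. Qed.

Definition sqdist c (y : R) : \bar R := ((y - c) ^+ 2)%:E.

Lemma nnmeas_sqdist c : nnmeas (sqdist c).
Proof.
split; last by move=> y; rewrite lee_fin sqr_ge0.
by apply/measurable_EFinP; apply: measurable_funX; exact: measurable_funB.
Qed.

Lemma nnmeas_cst (c : \bar R) : (0 <= c)%E -> nnmeas (fun=> c).
Proof. by []. Qed.

Lemma nnmeasD h1 h2 : nnmeas h1 -> nnmeas h2 -> nnmeas (fun y => h1 y + h2 y)%E.
Proof.
by move=> [m1 p1] [m2 p2]; split; [exact: emeasurable_funD|move=> y; exact: adde_ge0].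
Qed.

Lemma min_op_sqdist k c y :
  min_op k (sqdist c) y = (sqdist (c - min_mean k) y + (min_var k)%:E)%E.
Proof.
transitivity (\int[F]_x (min_weight k x * (1 * x ^+ 2 + (2 * (y - c)) * x + (y - c) ^+ 2))%:E)%E.
  by apply: eq_integral => x _; rewrite /sqdist -EFinM; congr (_%:E); ring.
rewrite -[LHS]fineK; last first.
  apply: (integrable_fin_num measurableT).
  exact: (integrable_min_weightM k (integrable_quadratic _ _ _)).
rewrite -[X in X%:E]/(Rintegral _ _ _) Rintegral_min_weight_quadratic.
by rewrite /sqdist -EFinD min_var_square; congr (_%:E); ring.
Qed.

(* The expectation of h at y plus independent minima of m.+1, ..., m + c
   F-variables. *)
Fixpoint min_ops m c h : R -> \bar R :=
  if c is c'.+1 then min_op m (min_ops m.+1 c' h) else h.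

Lemma min_ops_add m c c' h : min_ops m (c + c') h = min_ops m c (min_ops (m + c) c' h).
Proof. by elim: c m => [|c IH] m /=; rewrite ?addn0// IH addSnnS. Qed.

Lemma nnmeas_min_ops m c h : nnmeas h -> nnmeas (min_ops m c h).
Proof. by elim: c m h => //= c IH m h gh; apply: nnmeas_min_op; exact: IH. Qed.

Lemma le_min_ops m c h1 h2 : nnmeas h1 -> nnmeas h2 -> (forall y, (h1 y <= h2 y)%E) ->
  forall y, (min_ops m c h1 y <= min_ops m c h2 y)%E.
Proof.
elim: c m => //= c IH m g1 g2 h12; apply: le_min_op; [exact: nnmeas_min_ops|exact: nnmeas_min_ops|].
exact: IH.
Qed.

Lemma min_opsD m c h1 h2 : nnmeas h1 -> nnmeas h2 ->
  forall y, min_ops m c (fun y => h1 y + h2 y)%E y = (min_ops m c h1 y + min_ops m c h2 y)%E.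
Proof.
elim: c m => //= c IH m g1 g2 y.
rewrite -min_opD; [|exact: nnmeas_min_ops|exact: nnmeas_min_ops].
by congr (min_op _ _ _); apply/funext => z; exact: IH.
Qed.

Lemma min_ops_cst m c (r : \bar R) y : (0 <= r)%E -> min_ops m c (fun=> r) y = r.
Proof.
move=> r0; elim: c m y => //= c IH m y.
by rewrite (_ : min_ops _ _ _ = fun=> r) ?min_op_cst//; apply/funext => z; exact: IH.
Qed.

Lemma min_ops_sqdist m c b y : min_ops m c (sqdist b) y =
  (sqdist (b - \sum_(m <= k < m + c) min_mean k) y + (\sum_(m <= k < m + c) min_var k)%:E)%E.
Proof.
elim: c m b y => [|c IH] m b y /=; first by rewrite addn0 !big_geq// subr0 adde0.
rewrite (_ : min_ops _ _ _ = fun y =>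
  sqdist (b - \sum_(m.+1 <= k < m.+1 + c) min_mean k) y + (\sum_(m.+1 <= k < m.+1 + c) min_var k)%:E)%E; last first.
  by apply/funext => z; exact: IH.
have V0 n n' : (0 <= (\sum_(n <= k < n') min_var k)%:E)%E.
  by rewrite lee_fin; apply: sumr_ge0 => k _; exact: min_var_ge0.
rewrite min_opD; [|exact: nnmeas_sqdist|exact: nnmeas_cst].
rewrite min_op_cst// min_op_sqdist -addeA -EFinD addSnnS.
rewrite !(@big_ltn _ _ _ m (m + c.+1)) ?addnS ?ltnS ?leq_addr//.
rewrite /sqdist -!EFinD; congr (_%:E); ring.
Qed.

End minimum_operators.

Lemma indic_rayN (R : realType) (x t : R) :
  \1_(`]-oo, x]%classic) t = (t <= x)%R%:R :> R.
Proof.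
rewrite indicE; congr (nat_of_bool _)%:R.
by apply/idP/idP; rewrite inE /= in_itv /=.
Qed.

Section nn_law.
Context (R : realType) (F : probability (measurableTypeR R) R).
Hypothesis F_atomless : forall t, F [set t] = 0%E.
Hypothesis F_nonneg : F [set t | 0 <= t] = 1%E.
Hypothesis F_square : F.-integrable setT (fun t => (t ^+ 2)%:E).

Local Notation survival := (survival F).
Local Notation min_weight := (min_weight F).
Local Notation min_op := (min_op F).
Local Notation min_ops := (min_ops F).
Local Notation min_mean := (min_mean F).
Local Notation min_var := (min_var F).
Local Notation min_square := (min_square F).

Lemma le_min_ops_cst m c h1 h2 r : nnmeas h1 -> nnmeas h2 -> 0 <= r ->
  (forall y, (h1 y <= h2 y + r%:E)%E) ->
  forall y, (min_ops m c h1 y <= min_ops m c h2 y + r%:E)%E.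
Proof.
move=> g1 g2 r0 h12 y; have gr : nnmeas (fun _ : R => r%:E) by exact: nnmeas_cst.
rewrite -[X in (_ <= _ + X)%E](@min_ops_cst _ F F_atomless F_nonneg m c _ y)//.
rewrite -min_opsD//; apply: le_min_ops => //; exact: nnmeasD.
Qed.

(* The first step examines p.+2 edges, one of which is also the closing edge z; the
   kernel is the joint density of the minimum x and of z, given that z is not the
   minimum. *)
Definition last_op p (h : R -> \bar R) (y : R) :=
  (\int[F]_x \int[F]_z
     ((p.+2%:R * survival x ^+ p * (x < z)%R%:R)%:E * h (y + x + z)%R))%E.

Let lw p x := p.+2%:R * survival x ^+ p.

Let lw_ge0 p x : 0 <= lw p x.
Proof. by rewrite mulr_ge0// exprn_ge0// survival_ge0. Qed.

Let measurable_lw p : measurable_fun [set: measurableTypeR R] (lw p).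
Proof. by apply: measurable_funM => //; apply: measurable_funX; exact: measurable_survival. Qed.

Let lw_survival p x : lw p x * survival x = min_weight p.+1 x.
Proof. by rewrite /lw /min_weight -mulrA -exprSr. Qed.

Let integral_lw p : (\int[F]_x (lw p x)%:E = (p.+2%:R / p.+1%:R)%:E)%E.
Proof.
under eq_integral do rewrite EFinM.
rewrite ge0_integralZl//; last 2 first.
- exact: measurable_survivalX.
- by move=> x _; rewrite lee_fin exprn_ge0// survival_ge0.
by rewrite integral_survivalX.
Qed.

Let integralZl (c : R) (g : measurableTypeR R -> \bar R) : 0 <= c ->
  measurable_fun setT g -> (forall z, 0 <= g z)%E ->
  (\int[F]_z (c%:E * g z) = c%:E * \int[F]_z g z)%E.
Proof. by move=> c0 mg g0; rewrite ge0_integralZl. Qed.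

Let measurable_above x : measurable_fun [set: measurableTypeR R] (fun z => ((x < z)%R%:R)%:E : \bar R).
Proof. by apply/measurable_EFinP; exact: measurable_ltrR. Qed.

Let integral_above x : (\int[F]_z ((x < z)%R%:R)%:E = (survival x)%:E)%E.
Proof.
rewrite survivalE -[X in F X]setIT -integral_indic//; apply: eq_integral => t _.
by rewrite indic_ray.
Qed.

Let F_ae : {ae F, forall x : R, 0 <= x}.
Proof.
have mp : measurable ([set t | 0 <= t] : set (measurableTypeR R)).
  rewrite (_ : [set t | 0 <= t] = `[0, +oo[%classic)//.
  by apply/seteqP; split => t /=; rewrite in_itv /= andbT.
exists (~` [set t | 0 <= t]); split => //; first exact: measurableC.
by rewrite probability_setC// F_nonneg subee.
Qed.

Let K p (h : R -> \bar R) (q : R * (measurableTypeR R * measurableTypeR R)) : \bar R :=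
  ((p.+2%:R * survival q.2.1 ^+ p * (q.2.1 < q.2.2)%R%:R)%:E * h (q.1 + q.2.1 + q.2.2)%R)%E.

Let mlast1 p h : nnmeas h -> measurable_fun [set: R * measurableTypeR R]
  (fun q => \int[F]_z
     ((p.+2%:R * survival q.2 ^+ p * (q.2 < z)%R%:R)%:E * h (q.1 + q.2 + z)%R))%E.
Proof.
move=> [mh h0].
apply: (@measurable_fun_fubini_tonelli_F _ _ (R * measurableTypeR R)%type (measurableTypeR R) R F
  (fun q => (p.+2%:R * survival q.1.2 ^+ p * (q.1.2 < q.2)%R%:R)%:E * h (q.1.1 + q.1.2 + q.2)%R)%E).
  have m12 : measurable_fun [set: R * measurableTypeR R * measurableTypeR R] (fun q => q.1.2).
    exact: (measurableT_comp measurable_snd).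
  have m11 : measurable_fun [set: R * measurableTypeR R * measurableTypeR R] (fun q => q.1.1).
    exact: (measurableT_comp measurable_fst).
  have m2 : measurable_fun [set: R * measurableTypeR R * measurableTypeR R] snd.
    exact: measurable_snd.
  apply: emeasurable_funM.
    apply/measurable_EFinP; apply: measurable_funM.
      exact: (measurableT_comp (measurable_lw p)).
    exact: measurable_ltrR.
  apply: (measurableT_comp mh); apply: measurable_funD => //; exact: measurable_funD.
by move=> q; rewrite mule_ge0// lee_fin mulr_ge0// lw_ge0.
Qed.

Lemma nnmeas_last_op p h : nnmeas h -> nnmeas (last_op p h).
Proof.
move=> gh; have [mh h0] := gh.
split; last first.
  by move=> y; do 2 (apply: integral_ge0 => ? _); rewrite mule_ge0// lee_fin mulr_ge0// lw_ge0.
apply: (@measurable_fun_fubini_tonelli_F _ _ R (measurableTypeR R) R F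
  (fun q => \int[F]_z
     ((p.+2%:R * survival q.2 ^+ p * (q.2 < z)%R%:R)%:E * h (q.1 + q.2 + z)%R))%E).
  exact: mlast1.
by move=> q; apply: integral_ge0 => z _; rewrite mule_ge0// lee_fin mulr_ge0// lw_ge0.
Qed.

Lemma measurable_last_op_inner p h y : nnmeas h -> measurable_fun [set: measurableTypeR R]
  (fun x => \int[F]_z
     ((p.+2%:R * survival x ^+ p * (x < z)%R%:R)%:E * h (y + x + z)%R))%E.
Proof.
move=> gh; have := mlast1 p gh.
move=> mq; apply: (measurableT_comp mq (g := fun x : measurableTypeR R => (y, x))).
exact: measurable_fun_pair.
Qed.

Let mker p h y x : nnmeas h -> measurable_fun [set: measurableTypeR R]
  (fun z => (p.+2%:R * survival x ^+ p * (x < z)%R%:R)%:E * h (y + x + z)%R)%E.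
Proof.
move=> [mh h0]; apply: emeasurable_funM.
  by apply/measurable_EFinP; apply: measurable_funM => //; exact: measurable_ltrR.
by apply: (measurableT_comp mh); exact: measurable_funD.
Qed.

Let ker0 p h y x z : nnmeas h ->
  (0 <= (p.+2%:R * survival x ^+ p * (x < z)%R%:R)%:E * h (y + x + z)%R)%E.
Proof. by move=> [_ h0]; rewrite mule_ge0// lee_fin mulr_ge0// lw_ge0. Qed.

Definition below t (y : R) : \bar R := ((y <= t)%R%:R)%:E.
Definition above t (y : R) : \bar R := ((t < y)%R%:R)%:E.

Lemma nnmeas_below t : nnmeas (below t).
Proof.
split; last by move=> y; rewrite lee_fin.
by rewrite /below; apply/measurable_EFinP; exact: measurable_lerR.
Qed.

Lemma nnmeas_above t : nnmeas (above t).
Proof.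
split; last by move=> y; rewrite lee_fin.
by rewrite /above; apply/measurable_EFinP; exact: measurable_ltrR.
Qed.

Lemma integral_below t : (\int[F]_z below t z = (mcdf F t)%:E)%E.
Proof.
rewrite /mcdf fineK ?fin_num_measure// -[X in F X]setIT -integral_indic//.
by apply: eq_integral => z _; rewrite indic_rayN.
Qed.

Lemma last_op_le p h y (a b : R) : nnmeas h -> 0 <= a -> 0 <= b ->
  (forall x, 0 <= x -> (\int[F]_z
     ((x < z)%R%:R%:E * h (y + x + z)%R) <= (a + survival x * b * x ^+ 2)%:E)%E) ->
  (last_op p h y <= (a * (p.+2%:R / p.+1%:R) + b * min_square p.+1)%:E)%E.
Proof.
move=> gh a0 b0 H.
have ilw : F.-integrable setT (EFin \o lw p).
  apply/integrableP; split; first exact/measurable_EFinP.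
  under eq_integral do rewrite /= ger0_norm//.
  by rewrite integral_lw ltry.
have isq : F.-integrable setT (EFin \o (fun x => min_weight p.+1 x * x ^+ 2)).
  exact: integrable_min_weightM.
have iZ (r : R) (g : R -> R) : F.-integrable setT (EFin \o g) ->
    F.-integrable setT (EFin \o (fun x => r * g x)).
  by move=> ig; apply: eq_integrable (integrableZl measurableT r ig).
have ir := integrableD_real (iZ a _ ilw) (iZ b _ isq).
have -> : ((a * (p.+2%:R / p.+1%:R) + b * min_square p.+1)%:E =
    \int[F]_x (a * lw p x + b * (min_weight p.+1 x * x ^+ 2))%:E)%E.
  rewrite -[RHS]fineK; last exact: (integrable_fin_num measurableT ir).
  rewrite -[X in _ = X%:E]/(Rintegral _ _ _) RintegralD//; [|exact: iZ|exact: iZ].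
  rewrite (RintegralZl a measurableT ilw) (RintegralZl b measurableT isq).
  by congr (a * _ + _)%:E; rewrite /Rintegral integral_lw.
apply: ae_ge0_le_integral => //.
- by move=> x _; apply: integral_ge0 => z _; exact: ker0.
- exact: measurable_last_op_inner.
- move=> x _; rewrite lee_fin addr_ge0// mulr_ge0// ?lw_ge0//.
  by rewrite mulr_ge0 ?sqr_ge0// min_weight_ge0.
- by move/measurable_int: ir.
have [N [mN N0 HN]] := F_ae; exists N; split => // x /= nx; apply: HN => /=.
apply: contra_not nx => x0 _.
have [mh h0] := gh.
have -> : (\int[F]_z ((p.+2%:R * survival x ^+ p * (x < z)%R%:R)%:E * h (y + x + z)%R) =
    (lw p x)%:E * \int[F]_z ((x < z)%R%:R%:E * h (y + x + z)%R))%E.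
  rewrite -integralZl//; last first.
  - by move=> z; rewrite mule_ge0// lee_fin.
  - apply: emeasurable_funM => //.
    by apply: (measurableT_comp mh); exact: measurable_funD.
  by apply: eq_integral => z _; rewrite muleA -EFinM.
apply: le_trans (lee_wpmul2l _ (H x x0)) _; first by rewrite lee_fin lw_ge0.
by rewrite -EFinM lee_fin -lw_survival le_eqVlt; apply/orP; left; apply/eqP; ring.
Qed.


Lemma last_op_le_mcdf p t y : (last_op p (below t) y <= (mcdf F (t - y) + p.+1%:R^-1)%:E)%E.
Proof.
have m0 : 0 <= mcdf F (t - y) by rewrite fine_ge0.
have m1 : mcdf F (t - y) <= 1 by rewrite -lee_fin fineK ?fin_num_measure// probability_le1.
have H x : 0 <= x -> (\int[F]_z ((x < z)%R%:R%:E * below t (y + x + z)%R) <=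
    (mcdf F (t - y) + survival x * 0 * x ^+ 2)%:E)%E.
  move=> x0; rewrite mulr0 mul0r addr0 -integral_below.
  apply: ge0_le_integral => //.
  - by move=> z _; rewrite mule_ge0// lee_fin.
  - apply: emeasurable_funM => //.
    by apply/measurable_EFinP; apply: measurable_lerR => //; exact: measurable_funD.
  - by have [] := nnmeas_below (t - y).
  move=> z _; rewrite /below -EFinM lee_fin.
  have [xz|_] := ltP x z; last by rewrite mul0r.
  rewrite mul1r ler_nat; case: (leP (y + x + z) t) => // yxz.
  by rewrite (_ : z <= t - y)//; lra.
apply: le_trans (last_op_le p (nnmeas_below t) m0 (lexx 0) H) _.
rewrite mul0r addr0 lee_fin.
have p0 : 0 < p.+1%:R :> R by rewrite ltr0n.
rewrite -[p.+2%:R]natr1 mulrDl divff ?gt_eqF// mulrDr mulr1 lerD2l mul1r.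
by rewrite ler_piMl// invr_ge0 ltW.
Qed.

Lemma last_op_above_le p t y d : 0 < d ->
  (last_op p (above t) y <=
   ((1 - mcdf F (t - y - d)) * (p.+2%:R / p.+1%:R) + (d ^- 2) * min_square p.+1)%:E)%E.
Proof.
move=> d0.
have m1 : mcdf F (t - y - d) <= 1 by rewrite -lee_fin fineK ?fin_num_measure// probability_le1.
have d2 : 0 <= d ^- 2 by rewrite invr_ge0 sqr_ge0.
apply: last_op_le => //; [exact: nnmeas_above|by rewrite subr_ge0|].
move=> x x0.
have mA s : measurable_fun [set: measurableTypeR R] (fun z => (s < z)%R%:R : R).
  exact: measurable_ltrR.
have -> : (1 - mcdf F (t - y - d) + survival x * d ^- 2 * x ^+ 2)%:E =
    (\int[F]_z (((t - y - d < z)%R%:R)%:E + (d ^- 2 * x ^+ 2)%:E * ((x < z)%R%:R)%:E))%E.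
  have mg2 : measurable_fun [set: measurableTypeR R]
      (fun z => (d ^- 2 * x ^+ 2)%:E * ((x < z)%R%:R)%:E)%E.
    exact: emeasurable_funM.
  have g20 z : (0 <= (d ^- 2 * x ^+ 2)%:E * ((x < z)%R%:R)%:E)%E.
    by rewrite mule_ge0// lee_fin mulr_ge0// sqr_ge0.
  rewrite ge0_integralD//.
  rewrite integralZl ?mulr_ge0 ?sqr_ge0//.
  by rewrite !integral_above !survival_mcdf -EFinM -EFinD; congr (_%:E); ring.
apply: ge0_le_integral => //.
- by move=> z _; rewrite mule_ge0// lee_fin.
- apply: emeasurable_funM; first exact/measurable_EFinP.
  by apply/measurable_EFinP; apply: measurable_ltrR => //; exact: measurable_funD.
- apply: emeasurable_funD; first exact/measurable_EFinP.
  by apply: emeasurable_funM => //; exact/measurable_EFinP.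
move=> z _; rewrite /above -!EFinM -EFinD lee_fin.
have [xz|_] := ltP x z; last by rewrite mul0r mulr0 addr0.
rewrite mul1r mulr1.
have [tz|tz] := ltP t (y + x + z); last by rewrite addr_ge0// mulr_ge0// sqr_ge0.
have [tyz|tyz] := ltP (t - y - d) z; first by rewrite lerDl mulr_ge0// sqr_ge0.
rewrite add0r mulrC ler_pdivlMr ?exprn_gt0// mul1r ler_sqr ?nnegrE// ?ltW//.
lra.
Qed.

Lemma last_opD p h1 h2 y : nnmeas h1 -> nnmeas h2 ->
  last_op p (fun y => h1 y + h2 y)%E y = (last_op p h1 y + last_op p h2 y)%E.
Proof.
move=> g1 g2; rewrite /last_op -ge0_integralD//.
- apply: eq_integral => x _; rewrite -ge0_integralD//.
  + apply: eq_integral => z _; rewrite ge0_muleDr//; [exact: g1.2|exact: g2.2].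
  + by move=> z _; exact: ker0.
  + exact: mker.
  + by move=> z _; exact: ker0.
  + exact: mker.
- by move=> x _; apply: integral_ge0 => z _; exact: ker0.
- exact: measurable_last_op_inner.
- by move=> x _; apply: integral_ge0 => z _; exact: ker0.
- exact: measurable_last_op_inner.
Qed.

Lemma last_op1 p y : last_op p (fun=> 1%E) y = 1%E.
Proof.
rewrite -[RHS](integral_min_weight F_atomless F_nonneg p.+1); apply: eq_integral => x _.
transitivity (\int[F]_z ((lw p x)%:E * ((x < z)%R%:R)%:E))%E.
  by apply: eq_integral => z _; rewrite mule1 -EFinM.
rewrite integralZl//.
by rewrite integral_above -EFinM lw_survival.
Qed.

Lemma last_op_ge_mcdf p t y d : 0 < d ->
  ((mcdf F (t - y - d))%:E <=
    last_op p (below t) y + (p.+1%:R^-1 + d ^- 2 * min_square p.+1)%:E)%E.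
Proof.
move=> d0.
have m0 : 0 <= mcdf F (t - y - d) by rewrite fine_ge0.
have E : (last_op p (below t) y + last_op p (above t) y = 1)%E.
  rewrite -(last_op1 p y) -last_opD; [|exact: nnmeas_below|exact: nnmeas_above].
  congr (last_op p _ y); apply/funext => z; rewrite /below /above -EFinD; congr (_%:E).
  by have [] := leP z t; rewrite ?addr0 ?add0r.
have B0 : (0 <= last_op p (below t) y)%E by exact: (nnmeas_last_op p (nnmeas_below t)).2.
have A0 : (0 <= last_op p (above t) y)%E by exact: (nnmeas_last_op p (nnmeas_above t)).2.
move: (last_op_above_le p t y d0) E B0 A0; set B := last_op _ (below _) _; set A := last_op _ (above _) _.
move: B A => [B| |] [A| |]//; rewrite !lee_fin -EFinD => AB [E] _ A0.
have p0 : 0 < p.+1%:R :> R by rewrite ltr0n.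
have i0 : 0 < p.+1%:R^-1 :> R by rewrite invr_gt0.
have pp : p.+2%:R / p.+1%:R = 1 + p.+1%:R^-1 :> R.
  by rewrite -[p.+2%:R]natr1 mulrDl divff ?gt_eqF// mul1r.
rewrite pp in AB.
set q := mcdf _ _ in m0 AB *; set i := p.+1%:R^-1 in i0 AB *.
have : q * i >= 0 by rewrite mulr_ge0// ltW.
rewrite mulrDr mulr1 mulrBl mul1r in AB.
lra.
Qed.

Definition mean := (\int[F]_x x)%R.

Definition mean_above x := (\int[F]_z ((x < z)%R%:R * z))%R.

Let iid : F.-integrable setT (EFin \o (fun x : R => x)) := integrable_id F_square.

Let iabove x : F.-integrable setT (EFin \o (fun z => (x < z)%R%:R * z)).
Proof.
apply: le_integrable iid => //.
  by apply/measurable_EFinP; apply: measurable_funM => //; exact: measurable_ltrR.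
move=> z _ /=; rewrite lee_fin normrM ler_piMl//.
by case: (x < z); rewrite ?normr1 ?normr0.
Qed.

Let ae_Rintegral_ge0 (g : R -> R) : (forall x, 0 <= x -> 0 <= g x) ->
  F.-integrable setT (EFin \o g) -> 0 <= (\int[F]_x g x)%R.
Proof.
move=> g0 ig; rewrite /Rintegral.
rewrite (_ : (\int[F]_x (g x)%:E = \int[F]_x (Num.max (g x) 0)%:E)%E).
  by apply: fine_ge0; apply: integral_ge0 => x _; rewrite lee_fin le_max lexx orbT.
apply: ae_eq_integral => //.
- by move/measurable_int : ig.
- by move/measurable_int : ig => /measurable_EFinP mg; apply/measurable_EFinP; exact: measurable_maxr.
have [N [mN N0 HN]] := F_ae; exists N; split => // x /= nx; apply: HN => /=.
by apply: contra_not nx => x0 _; rewrite max_l// g0.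
Qed.

Let ae_le_Rintegral (g h : R -> R) : (forall x, 0 <= x -> g x <= h x) ->
  F.-integrable setT (EFin \o g) -> F.-integrable setT (EFin \o h) ->
  (\int[F]_x g x)%R <= (\int[F]_x h x)%R.
Proof.
move=> gh ig ih; rewrite -subr_ge0 -RintegralB//; apply: ae_Rintegral_ge0.
  by move=> x x0; rewrite subr_ge0 gh.
by apply: eq_integrable (integrableB measurableT ih ig).
Qed.

Lemma mean_above_le x : mean_above x <= mean.
Proof.
apply: ae_le_Rintegral => // z z0; case: (x < z); rewrite ?mul1r// mul0r//.
Qed.

Lemma mean_above_ge x : 0 <= x -> survival x * mean <= mean_above x.
Proof.
move=> x0.
have Rabove : (\int[F]_z (x < z)%R%:R)%R = survival x by rewrite /Rintegral integral_above.
have ind_i : F.-integrable setT (EFin \o (fun z : R => (x < z)%R%:R : R)).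
  apply/integrableP; split; first exact: measurable_above.
  under eq_integral do rewrite /= normr_nat.
  by rewrite integral_above ltry.
have E1 : x * survival x <= mean_above x.
  rewrite -Rabove -RintegralZl//; apply: le_Rintegral => //.
    by apply: eq_integrable (integrableZl measurableT x ind_i).
  by move=> z _; have [xz|_] := ltP x z; rewrite ?mulr1 ?mul1r ?mulr0 ?mul0r// ltW.
have E2 : mean <= mean_above x + x * (1 - survival x).
  have -> : mean_above x + x * (1 - survival x) =
     (\int[F]_z ((x < z)%R%:R * z + (x + - x * (x < z)%R%:R)))%R.
    have i2 : F.-integrable setT (EFin \o (fun z : R => - x * (x < z)%R%:R)).
      by apply: eq_integrable (integrableZl measurableT (- x) ind_i).
    rewrite RintegralD//; last exact: integrableD_real (integrable_cst_real _ _) _.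
    rewrite RintegralD//; last exact: integrable_cst_real.
    rewrite RintegralZl// Rabove Rintegral_cst//.
    rewrite (_ : fine _ = 1); last by rewrite [X in fine X](@probability_setT _ _ _ F).
    by congr (_ + _); ring.
  apply: le_Rintegral => //.
    apply: integrableD_real => //; apply: integrableD_real; first exact: integrable_cst_real.
    by apply: eq_integrable (integrableZl measurableT (- x) ind_i).
  by move=> z _; have [xz|xz] := ltP x z; rewrite ?mulr1 ?mul1r ?mulr0 ?mul0r ?addr0 ?add0r ?subrr ?addr0.
have s0 := survival_ge0 F x; have s1 := survival_le1 F x.
have : survival x * mean <= survival x * (mean_above x + x * (1 - survival x)) by rewrite ler_wpM2l.
have : (1 - survival x) * (x * survival x) <= (1 - survival x) * mean_above x.
  by rewrite ler_wpM2l// subr_ge0.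
lra.
Qed.


Let ae_eq_integral_nonneg (g h : measurableTypeR R -> \bar R) :
  measurable_fun setT g -> measurable_fun setT h ->
  (forall x, 0 <= g x)%E -> (forall x, 0 <= h x)%E ->
  (forall x : R, 0 <= x -> g x = h x) -> (\int[F]_x g x = \int[F]_x h x)%E.
Proof.
move=> mg mh g0 h0 gh; apply: ge0_ae_eq_integral => //.
have [N [mN N0 HN]] := F_ae; exists N; split => // x /= nx; apply: HN => /=.
by apply: contra_not nx => x0 _; exact: gh.
Qed.

Let ae_le_integral_nonneg (g h : measurableTypeR R -> \bar R) :
  measurable_fun setT g -> measurable_fun setT h ->
  (forall x, 0 <= g x)%E -> (forall x, 0 <= h x)%E ->
  (forall x : R, (0 <= x)%R -> g x <= h x)%E -> (\int[F]_x g x <= \int[F]_x h x)%E.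
Proof.
move=> mg mh g0 h0 gh; apply: ae_ge0_le_integral => //.
have [N [mN N0 HN]] := F_ae; exists N; split => // x /= nx; apply: HN => /=.
by apply: contra_not nx => x0 _; exact: gh.
Qed.

Lemma min_op_shift k h c : nnmeas h -> 0 <= c -> (forall y, 0 <= y -> h y = (y + c)%:E) ->
  forall y, 0 <= y -> min_op k h y = (y + c + min_mean k)%:E.
Proof.
move=> gh c0 hE y y0.
transitivity (\int[F]_x (min_weight k x * (0 * x ^+ 2 + 1 * Num.max x 0 + (y + c)))%:E)%E.
  apply: ae_eq_integral_nonneg.
  - exact: measurable_min_op_integrand.
  - apply/measurable_EFinP; apply: measurable_funM; first exact: measurable_min_weight.
    apply: measurable_funD => //; apply: measurable_funD.
      by apply: measurable_funM => //; exact: measurable_funX.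
    by apply: measurable_funM => //; exact: measurable_maxr.
  - by move=> x; exact: min_op_integrand_ge0.
  - move=> x; rewrite lee_fin mulr_ge0// ?min_weight_ge0// mul0r add0r mul1r !addr_ge0//.
    by rewrite le_max lexx orbT.
  move=> x x0; rewrite hE ?addr_ge0// -EFinM max_l//; congr (_%:E); ring.
transitivity (\int[F]_x (min_weight k x * (0 * x ^+ 2 + 1 * x + (y + c)))%:E)%E.
  apply: ae_eq_integral => //.
  - apply/measurable_EFinP; apply: measurable_funM; first exact: measurable_min_weight.
    apply: measurable_funD => //; apply: measurable_funD.
      by apply: measurable_funM => //; exact: measurable_funX.
    by apply: measurable_funM => //; exact: measurable_maxr.
  - by move/measurable_int: (integrable_min_weightM k (integrable_quadratic F_square 0 1 (y + c))).
  have [N [mN N0 HN]] := F_ae; exists N; split => // x /= nx; apply: HN => /=.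
  by apply: contra_not nx => x0 _; rewrite max_l.
rewrite -[LHS]fineK; last first.
  apply: (integrable_fin_num measurableT).
  exact: (integrable_min_weightM k (integrable_quadratic F_square _ _ _)).
rewrite -[X in X%:E]/(Rintegral _ _ _) Rintegral_min_weight_quadratic//.
by congr (_%:E); ring.
Qed.

Lemma min_ops_vanish m c h : nnmeas h -> (forall y, 0 <= y -> h y = 0%E) ->
  forall y, 0 <= y -> min_ops m c h y = 0%E.
Proof.
move=> gh h0; elim: c m => [|c IH] m y y0 /=; first exact: h0.
have gm := nnmeas_min_ops F m.+1 c gh.
rewrite -(integral0 F setT); apply: ae_eq_integral_nonneg => //.
- exact: measurable_min_op_integrand.
- by move=> x; exact: min_op_integrand_ge0.
- by move=> x x0; rewrite IH ?addr_ge0// mule0.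
Qed.

Lemma last_op_vanish p h y : nnmeas h -> (forall y, 0 <= y -> h y = 0%E) -> 0 <= y ->
  last_op p h y = 0%E.
Proof.
move=> gh h0 y0; rewrite -(integral0 F setT); apply: ae_eq_integral_nonneg => //.
- exact: measurable_last_op_inner.
- by move=> x; apply: integral_ge0 => z _; exact: ker0.
move=> x x0; apply: integral0_eq => z _.
have [xz|_] := ltP x z; last by rewrite mulr0 mul0e.
by rewrite h0 ?mule0// !addr_ge0// ltW// (le_lt_trans x0).
Qed.

Lemma min_mean_ge0 k : 0 <= min_mean k.
Proof.
apply: ae_Rintegral_ge0; last exact: integrable_min_weightM iid.
by move=> x x0; rewrite mulr_ge0// min_weight_ge0.
Qed.

Lemma min_ops_shift m n h c : nnmeas h -> 0 <= c -> (forall y, 0 <= y -> h y = (y + c)%:E) ->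
  forall y, 0 <= y -> min_ops m n h y = (y + c + \sum_(m <= k < m + n) min_mean k)%:E.
Proof.
move=> gh c0 hE; elim: n m => [|n IH] m y y0 /=; first by rewrite addn0 big_geq// addr0 hE.
have S0 : 0 <= \sum_(m.+1 <= k < m.+1 + n) min_mean k.
  by apply: sumr_ge0 => k _; exact: min_mean_ge0.
rewrite (min_op_shift m (nnmeas_min_ops F _ _ gh) (addr_ge0 c0 S0))//.
  rewrite addSnnS [in RHS]big_ltn ?addnS ?ltnS ?leq_addr//.
  by congr (_%:E); ring.
by move=> z z0; rewrite IH// addrA.
Qed.

Definition pos_part (y : R) : \bar R := (Num.max y 0)%:E.

Lemma nnmeas_pos_part : nnmeas pos_part.
Proof.
split; last by move=> y; rewrite lee_fin le_max lexx orbT.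
by rewrite /pos_part; apply/measurable_EFinP; exact: measurable_maxr.
Qed.

Lemma last_op_cst p (c : R) y : 0 <= c -> last_op p (fun=> c%:E) y = c%:E.
Proof.
move=> c0; rewrite -[RHS]mule1 -(integral_min_weight F_atomless F_nonneg p.+1).
rewrite -integralZl//; last 2 first.
- by apply/measurable_EFinP; exact: measurable_min_weight.
- by move=> x; rewrite lee_fin min_weight_ge0.
apply: eq_integral => x _.
transitivity (\int[F]_z ((c * lw p x)%:E * ((x < z)%R%:R)%:E))%E.
  apply: eq_integral => z _; rewrite -!EFinM; congr (_%:E); rewrite /lw; ring.
rewrite (integralZl (mulr_ge0 c0 (lw_ge0 p x)))// integral_above -EFinM -lw_survival.
by congr (_%:E); ring.
Qed.

Lemma last_op_shift p y : 0 <= y ->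
  last_op p pos_part y = (y%:E + last_op p pos_part 0)%E.
Proof.
move=> y0; have gy : nnmeas (fun _ : R => y%:E) by exact: nnmeas_cst.
have gyp := nnmeasD gy nnmeas_pos_part.
transitivity (last_op p (fun _ : R => y%:E) 0 + last_op p pos_part 0)%E; last first.
  by congr (_ + _)%E; exact: last_op_cst.
rewrite -(last_opD p 0 gy nnmeas_pos_part).
apply: ae_eq_integral_nonneg.
- exact: (measurable_last_op_inner p y nnmeas_pos_part).
- exact: (measurable_last_op_inner p 0 gyp).
- by move=> x; apply: integral_ge0 => z _; exact: (ker0 p y x z nnmeas_pos_part).
- by move=> x; apply: integral_ge0 => z _; exact: (ker0 p 0 x z gyp).
move=> x x0; apply: eq_integral => z _; rewrite /pos_part.
have [xz|_] := ltP x z; last by rewrite mulr0 !mul0e.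
have z0 : 0 <= z by rewrite ltW// (le_lt_trans x0).
by rewrite -EFinD !max_l ?add0r ?addr_ge0// addrA.
Qed.

Let inner_pos_part p x : 0 <= x ->
  (\int[F]_z ((p.+2%:R * survival x ^+ p * (x < z)%R%:R)%:E * pos_part (0 + x + z)%R) =
   (lw p x * (survival x * x + mean_above x))%:E)%E.
Proof.
move=> x0.
have ind_i : F.-integrable setT (EFin \o (fun z : R => (x < z)%R%:R : R)).
  apply/integrableP; split; first exact: measurable_above.
  under eq_integral do rewrite /= normr_nat.
  by rewrite integral_above ltry.
have ix : F.-integrable setT (EFin \o (fun z : R => x * (x < z)%R%:R)).
  by apply: eq_integrable (integrableZl measurableT x ind_i).
have iS := integrableD_real ix (iabove x).
have iL : F.-integrable setT (EFin \o (fun z : R => lw p x * (x * (x < z)%R%:R + (x < z)%R%:R * z))).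
  by apply: eq_integrable (integrableZl measurableT (lw p x) iS).
transitivity (\int[F]_z (lw p x * (x * (x < z)%R%:R + (x < z)%R%:R * z))%:E)%E.
  apply: eq_integral => z _; rewrite /pos_part add0r -EFinM; congr (_%:E).
  have [xz|_] := ltP x z; last by rewrite /lw /= !(mulr0, mul0r, addr0, mulr1, mul1r).
  rewrite max_l; first by rewrite /lw /= !(mulr0, mul0r, addr0, mulr1, mul1r).
  by rewrite addr_ge0// ltW// (le_lt_trans x0).
rewrite -[LHS]fineK; last exact: (integrable_fin_num measurableT iL).
congr (_%:E); rewrite -[LHS]/(Rintegral _ _ _) RintegralZl//; congr (_ * _).
rewrite (RintegralD measurableT ix (iabove x)) (RintegralZl x measurableT ind_i).
by rewrite (_ : Rintegral _ _ _ = survival x) 1?mulrC// /Rintegral integral_above.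
Qed.

Lemma mean_ge0 : 0 <= mean.
Proof. by apply: ae_Rintegral_ge0. Qed.

Lemma last_op_pos_le p :
  (last_op p pos_part 0 <= (min_mean p.+1 + mean * (p.+2%:R / p.+1%:R))%:E)%E.
Proof.
have pE y : 0 <= y -> pos_part y = (y + 0)%:E.
  by move=> y0; rewrite /pos_part max_l// addr0.
have := min_op_shift p.+1 nnmeas_pos_part (lexx 0) pE (lexx 0); rewrite !add0r => mE.
have mlw' : measurable_fun [set: measurableTypeR R] (fun x => (lw p x)%:E).
  exact/measurable_EFinP.
have lw0' x : (0 <= (lw p x)%:E)%E by rewrite lee_fin.
have mlw : measurable_fun [set: measurableTypeR R] (fun x => mean%:E * (lw p x)%:E)%E.
  exact: emeasurable_funM.
have lw0 x : (0 <= mean%:E * (lw p x)%:E)%E by rewrite mule_ge0 ?lee_fin ?mean_ge0.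
rewrite EFinD EFinM -integral_lw -mE -(integralZl mean_ge0 mlw' lw0').
have mi := measurable_min_op_integrand F p.+1 0 nnmeas_pos_part.
have i0 x := min_op_integrand_ge0 F p.+1 0 x nnmeas_pos_part.
rewrite -ge0_integralD//; apply: ae_le_integral_nonneg.
- exact: (measurable_last_op_inner p 0 nnmeas_pos_part).
- exact: emeasurable_funD.
- by move=> x; apply: integral_ge0 => z _; exact: (ker0 p 0 x z nnmeas_pos_part).
- by move=> x; exact: adde_ge0.
move=> x x0; rewrite inner_pos_part// /pos_part add0r max_l// -!EFinM -EFinD lee_fin.
rewrite mulrDr mulrA lw_survival lerD2l [leRHS]mulrC ler_wpM2l//.
exact: mean_above_le.
Qed.

Lemma last_op_pos_ge p : (mean%:E <= last_op p pos_part 0)%E.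
Proof.
rewrite -[X in (X <= _)%E]mule1 -(integral_min_weight F_atomless F_nonneg p.+1).
have mw : measurable_fun [set: measurableTypeR R] (fun x => (min_weight p.+1 x)%:E).
  by apply/measurable_EFinP; exact: measurable_min_weight.
rewrite -integralZl ?mean_ge0//; last by move=> x; rewrite lee_fin min_weight_ge0.
apply: ae_le_integral_nonneg.
- exact: emeasurable_funM.
- exact: (measurable_last_op_inner p 0 nnmeas_pos_part).
- by move=> x; rewrite mule_ge0// lee_fin ?mean_ge0// min_weight_ge0.
- by move=> x; apply: integral_ge0 => z _; exact: (ker0 p 0 x z nnmeas_pos_part).
move=> x x0; rewrite inner_pos_part// -EFinM lee_fin -lw_survival.
rewrite mulrC -mulrA ler_wpM2l// (le_trans (mean_above_ge x0))//.
by rewrite lerDr mulr_ge0// survival_ge0.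
Qed.

Definition last_mean p := fine (last_op p pos_part 0).

Lemma last_meanE p : last_op p pos_part 0 = (last_mean p)%:E.
Proof.
rewrite /last_mean fineK// ge0_fin_numE; first exact: le_lt_trans (last_op_pos_le p) (ltry _).
exact: (nnmeas_last_op p nnmeas_pos_part).2.
Qed.

Definition nn_mean p := \sum_(0 <= k < p.+1) min_mean k + last_mean p.

Lemma min_ops_last_op_pos p :
  min_ops 0 p.+1 (last_op p pos_part) 0 = (nn_mean p)%:E.
Proof.
have l0 : 0 <= last_mean p.
  by rewrite -lee_fin -last_meanE; exact: (nnmeas_last_op p nnmeas_pos_part).2.
rewrite (@min_ops_shift 0 p.+1 _ (last_mean p))//; last 2 first.
- exact: nnmeas_last_op nnmeas_pos_part.
- by move=> y y0; rewrite last_op_shift// last_meanE EFinD.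
by rewrite add0r addrC add0n.
Qed.

Definition nn_cdf p x := min_ops 0 p.+1 (last_op p (below (x + nn_mean p))) 0.

Definition shifted_cdf u (y : R) : \bar R := (mcdf F (u - y))%:E.

Lemma nnmeas_shifted_cdf u : nnmeas (shifted_cdf u).
Proof.
split; last by move=> y; rewrite lee_fin fine_ge0.
rewrite /shifted_cdf; apply/measurable_EFinP; apply: nonincreasing_measurable => // y z yz.
by apply: mcdf_nondecreasing; rewrite lerD2l lerN2.
Qed.

Lemma mcdf_ge0 x : 0 <= mcdf F x.
Proof. by rewrite fine_ge0. Qed.

Lemma mcdf_le1 x : mcdf F x <= 1.
Proof. by rewrite -lee_fin fineK ?fin_num_measure// probability_le1. Qed.

Lemma shifted_cdf_le u u' y y' e d : 0 < d -> 0 <= e ->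
  (forall x, mcdf F (x + d) <= mcdf F x + e) ->
  (shifted_cdf u' y' <= shifted_cdf u y + (e + d ^- 2 * (u' - y' - (u - y)) ^+ 2)%:E)%E.
Proof.
move=> d0 e0 Fd; rewrite /shifted_cdf -EFinD lee_fin.
have s0 : 0 <= d ^- 2 * (u' - y' - (u - y)) ^+ 2 by rewrite mulr_ge0 ?invr_ge0 ?sqr_ge0.
have [close|far] := leP (u' - y') (u - y + d).
  apply: le_trans (mcdf_nondecreasing _ close) _.
  by apply: le_trans (Fd _) _; rewrite lerD2l lerDl.
apply: le_trans (mcdf_le1 _) _.
have : 1 <= d ^- 2 * (u' - y' - (u - y)) ^+ 2.
  rewrite mulrC ler_pdivlMr ?exprn_gt0// mul1r ler_sqr ?nnegrE ?(ltW d0)//; lra.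
by have := mcdf_ge0 (u - y); lra.
Qed.

Let msum m c := \sum_(m <= k < m + c) min_mean k.
Let vsum m c := \sum_(m <= k < m + c) min_var k.

Lemma min_ops_scaled_sqdist m c b y r : 0 <= r ->
  min_ops m c (fun y => r%:E * sqdist b y)%E y = (r * ((y - (b - msum m c)) ^+ 2 + vsum m c))%:E.
Proof.
move=> r0.
have : min_ops m c (fun y => r%:E * sqdist b y)%E y = (r%:E * min_ops m c (sqdist b) y)%E.
  elim: c m y => //= c IH m y.
  rewrite (_ : min_ops m.+1 c _ = fun y => r%:E * min_ops m.+1 c (sqdist b) y)%E; last first.
    by apply/funext => z; exact: IH.
  have gs := nnmeas_min_ops F m.+1 c (nnmeas_sqdist b).
  rewrite -integralZl//; last 2 first.
  - exact: measurable_min_op_integrand.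
  - by move=> x; exact: min_op_integrand_ge0.
  by apply: eq_integral => x _; rewrite muleCA.
move=> ->; rewrite min_ops_sqdist// -EFinD -EFinM //.
Qed.

Lemma min_ops_shifted_cdf_le m c u y e d : 0 < d -> 0 <= e ->
  (forall x, mcdf F (x + d) <= mcdf F x + e) ->
  (min_ops m c (shifted_cdf (u + msum m c)) y <=
   shifted_cdf u y + (e + d ^- 2 * vsum m c)%:E)%E.
Proof.
move=> d0 e0 Fd.
have d2 : 0 <= d ^- 2 by rewrite invr_ge0 sqr_ge0.
have gq : nnmeas (fun y' => (d ^- 2)%:E * sqdist (y + msum m c) y')%E.
  have [ms s0] := nnmeas_sqdist (y + msum m c).
  by split; [apply: emeasurable_funM|move=> z; rewrite mule_ge0// lee_fin].
have gc : nnmeas (fun _ : R => shifted_cdf u y + e%:E)%E.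
  by apply: nnmeas_cst; rewrite -EFinD lee_fin addr_ge0// mcdf_ge0.
have -> : (shifted_cdf u y + (e + d ^- 2 * vsum m c)%:E =
    min_ops m c (fun y' => (shifted_cdf u y + e%:E) + (d ^- 2)%:E * sqdist (y + msum m c) y') y)%E.
  rewrite min_opsD// min_ops_cst//; last by have [_] := gc; apply.
  rewrite min_ops_scaled_sqdist// /shifted_cdf -!EFinD; congr (_%:E).
  by rewrite addrK subrr expr0n add0r addrA.
apply: le_min_ops => //; [exact: nnmeas_shifted_cdf|exact: nnmeasD|].
move=> y'; apply: le_trans (shifted_cdf_le u (u + msum m c) y y' d0 e0 Fd) _.
rewrite EFinD addeA /sqdist -EFinM leeD2l// lee_fin ler_wpM2l//.
rewrite le_eqVlt; apply/orP; left; apply/eqP; ring.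
Qed.

Lemma min_ops_shifted_cdf_ge m c u y e d : 0 < d -> 0 <= e ->
  (forall x, mcdf F (x + d) <= mcdf F x + e) ->
  (shifted_cdf u y <= min_ops m c (shifted_cdf (u + msum m c)) y +
     (e + d ^- 2 * vsum m c)%:E)%E.
Proof.
move=> d0 e0 Fd.
have d2 : 0 <= d ^- 2 by rewrite invr_ge0 sqr_ge0.
have gq : nnmeas (fun y' => (d ^- 2)%:E * sqdist (y + msum m c) y')%E.
  have [ms s0] := nnmeas_sqdist (y + msum m c).
  by split; [apply: emeasurable_funM|move=> z; rewrite mule_ge0// lee_fin].
have ge : nnmeas (fun _ : R => e%:E) by exact: nnmeas_cst.
have gs := nnmeas_shifted_cdf (u + msum m c).
rewrite -[X in (X <= _)%E](min_ops_cst F_atomless F_nonneg m c y); last first.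
  by rewrite lee_fin mcdf_ge0.
have -> : (min_ops m c (shifted_cdf (u + msum m c)) y + (e + d ^- 2 * vsum m c)%:E =
    min_ops m c (fun y' => shifted_cdf (u + msum m c) y' + (e%:E + (d ^- 2)%:E * sqdist (y + msum m c) y')) y)%E.
  rewrite min_opsD//; last exact: nnmeasD.
  rewrite min_opsD// min_ops_cst// min_ops_scaled_sqdist//.
  by rewrite addrK subrr expr0n add0r -EFinD.
apply: le_min_ops => //.
- by apply: nnmeas_cst; rewrite lee_fin mcdf_ge0.
- by apply: nnmeasD => //; exact: nnmeasD.
move=> y'; apply: le_trans (shifted_cdf_le (u + msum m c) u y' y d0 e0 Fd) _.
rewrite EFinD /sqdist -EFinM leeD2l// leeD2l// lee_fin ler_wpM2l//.
rewrite le_eqVlt; apply/orP; left; apply/eqP; ring.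
Qed.

End nn_law.

Section nn_cauchy.
Context (R : realType) (F : probability (measurableTypeR R) R).
Hypothesis F_atomless : forall t, F [set t] = 0%E.
Hypothesis F_nonneg : F [set t | 0 <= t] = 1%E.
Hypothesis F_square : F.-integrable setT (fun t => (t ^+ 2)%:E).
Hypothesis F_modulus : forall e, 0 < e -> exists2 d, 0 < d &
  forall x, mcdf F (x + d) <= mcdf F x + e.
Hypothesis F_sum : exists B, forall n, \sum_(0 <= k < n) min_square F k <= B.

Local Notation min_ops := (min_ops F).
Local Notation min_mean := (min_mean F).
Local Notation min_var := (min_var F).
Local Notation min_square := (min_square F).
Local Notation mean := (mean F).

Lemma min_square_ge0 k : 0 <= min_square k.
Proof. exact: le_trans (min_var_ge0 F k) (min_var_le F_atomless F_nonneg F_square k). Qed.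

Lemma min_square_tail t : 0 < t -> exists N, forall m c, (N <= m)%N ->
  \sum_(m <= k < m + c) min_square k <= t.
Proof.
move=> t0; have [B HB] := F_sum.
pose u n := \sum_(0 <= k < n) min_square k.
have nu : nondecreasing_seq u.
  apply/nondecreasing_seqP => n; rewrite /u big_nat_recr//= lerDl; exact: min_square_ge0.
have ucvg : cvgn u.
  by apply: nondecreasing_is_cvgn => //; exists B => _ [n _ <-]; exact: HB.
have ul n : u n <= limn u by apply: nondecreasing_cvgn_le.
have /cvgrPdist_le/(_ _ t0)[N _ HN] := ucvg.
exists N => m c Nm.
have E : u (m + c)%N = u m + \sum_(m <= k < m + c) min_square k.
  by rewrite /u -big_cat_nat// leq_addr.
have := HN m Nm; have := ul (m + c)%N; rewrite E => ? /ler_normlP[_ ?]; lra.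
Qed.

Lemma nn_cdf_cauchy e : 0 < e -> exists N, forall p q, (N <= p)%N -> (N <= q)%N ->
  forall x, (nn_cdf F p x <= nn_cdf F q x + e%:E)%E.
Proof.
move=> e0; pose e1 := e / 9.
have e10 : 0 < e1 by rewrite divr_gt0.
have [d d0 Fd] := F_modulus e10.
have mu0 := mean_ge0 F_nonneg F_square.
have d2 : 0 < d ^+ 2 by rewrite exprn_gt0.
have t0 : 0 < Num.min (e1 * d ^+ 2) ((d / 2) ^+ 2).
  by rewrite lt_min mulr_gt0// exprn_gt0// divr_gt0.
have [N1 HN1] := min_square_tail t0.
pose r := Num.min e1 (d / (2 * (mean + 1))).
have r0 : 0 < r by rewrite lt_min e10 divr_gt0// mulr_gt0// ltr_wpDl.
pose N := maxn N1 (Num.truncn r^-1).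
have inv_le p : (N <= p)%N -> p.+1%:R^-1 <= r.
  move=> Np; rewrite -[r]invrK lef_pV2 ?posrE ?invr_gt0 ?ltr0n//.
  apply/ltW/(lt_le_trans (Num.Theory.truncnS_gt _)); rewrite ler_nat ltnS.
  exact: leq_trans (leq_maxr _ _) Np.
have sq_le p : (N <= p)%N -> min_square p <= Num.min (e1 * d ^+ 2) ((d / 2) ^+ 2).
  move=> Np; have := HN1 p 1%N (leq_trans (leq_maxl _ _) Np).
  by rewrite addn1 big_nat1.
have lm p : (N <= p)%N -> mean <= last_mean F p <= mean + d.
  move=> Np; apply/andP; split.
    rewrite -lee_fin -last_meanE//; exact: last_op_pos_ge.
  rewrite -lee_fin -last_meanE//.
  apply: le_trans (last_op_pos_le F_atomless F_nonneg F_square p) _; rewrite lee_fin.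
  have m1 : min_mean p.+1 <= d / 2.
    rewrite -(ler_pXn2r (n := 2))// ?nnegrE ?min_mean_ge0 ?divr_ge0 ?(ltW d0)//.
    apply: le_trans (min_mean_le F_atomless F_nonneg F_square _) _.
    by apply: le_trans (sq_le _ (leqW Np)) _; rewrite ge_min lexx orbT.
  have m2 : mean * p.+1%:R^-1 <= d / 2.
    apply: (@le_trans _ _ ((mean + 1) * (d / (2 * (mean + 1))))).
      rewrite ler_pM ?invr_ge0// ?lerDl//.
      by apply: le_trans (inv_le _ Np) _; rewrite ge_min lexx orbT.
    rewrite le_eqVlt; apply/orP; left; apply/eqP; field.
    by rewrite gt_eqF// ltr_wpDl.
  rewrite -[p.+2%:R]natr1 mulrDl divff ?pnatr_eq0// mul1r mulrDr mulr1.
  rewrite addrCA lerD2l [leRHS]splitr; exact: lerD.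
have gs u : nnmeas (shifted_cdf F u) by exact: nnmeas_shifted_cdf.
have gl p t : nnmeas (last_op F p (below t)) by apply: nnmeas_last_op; exact: nnmeas_below.
pose u p x := x + mean + \sum_(0 <= k < p) min_mean k.
have up p x : (N <= p)%N ->
    (nn_cdf F p x <= min_ops 0 p.+1 (shifted_cdf F (u p.+1 x)) 0 + (2 * e1)%:E)%E.
  move=> Np; apply: le_min_ops_cst => //; first by rewrite mulr_ge0// ltW.
  move=> y; apply: le_trans (last_op_le_mcdf F_atomless F_nonneg F_square _ _ _) _.
  rewrite /shifted_cdf -EFinD lee_fin.
  have := inv_le _ Np; rewrite le_min => /andP[i1 _].
  have /andP[l1 l2] := lm _ Np.
  have Hm : mcdf F (x + nn_mean F p - y) <= mcdf F (u p.+1 x - y + d).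
    by apply: mcdf_nondecreasing; rewrite /nn_mean /u; lra.
  apply: le_trans (lerD (le_trans Hm (Fd _)) i1) _.
  rewrite -addrA lerD2l; lra.
have low p x : (N <= p)%N ->
    (min_ops 0 p.+1 (shifted_cdf F (u p.+1 x)) 0 <= nn_cdf F p x + (3 * e1)%:E)%E.
  move=> Np; apply: le_min_ops_cst => //; first by rewrite mulr_ge0// ltW.
  move=> y.
  have l0 := (gl p (x + nn_mean F p)).2 y.
  have : last_op F p (below (x + nn_mean F p)) y \is a fin_num.
    rewrite ge0_fin_numE//.
    exact: le_lt_trans (last_op_le_mcdf F_atomless F_nonneg F_square _ _ _) (ltry _).
  move=> lf; have := last_op_ge_mcdf F_atomless F_nonneg F_square p (x + nn_mean F p) y d0.
  rewrite /shifted_cdf -(fineK lf) -!EFinD !lee_fin => H.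
  have := inv_le _ Np; rewrite le_min => /andP[i1 _].
  have /andP[l1 l2] := lm _ Np.
  have dm : d ^- 2 * min_square p.+1 <= e1.
    rewrite mulrC ler_pdivrMr//.
    by apply: le_trans (sq_le _ (leqW Np)) _; rewrite ge_min lexx.
  have Hm : mcdf F (u p.+1 x - y) <= mcdf F (x + nn_mean F p - y - d + d).
    by apply: mcdf_nondecreasing; rewrite /nn_mean /u; lra.
  apply: le_trans Hm (le_trans (Fd _) (le_trans (lerD H (lexx e1)) _)).
  rewrite -!addrA lerD2l.
  apply: le_trans (lerD i1 (lerD dm (lexx e1))) _; lra.
have vs p : (N <= p)%N ->
    e1 + d ^- 2 * \sum_(N <= k < N + (p.+1 - N)) min_var k <= 2 * e1.
  move=> Np; rewrite mulrDl mul1r lerD2l mulrC ler_pdivrMr//.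
  apply: (@le_trans _ _ (\sum_(N <= k < N + (p.+1 - N)) min_square k)).
    by apply: ler_sum => k _; exact: min_var_le.
  by apply: le_trans (HN1 _ _ (leq_maxl _ _)) _; rewrite ge_min lexx.
have uE p x : (N <= p)%N ->
    u p.+1 x = u N x + \sum_(N <= k < N + (p.+1 - N)) min_mean k.
  move=> Np; rewrite /u subnKC ?(leqW Np)// -[RHS]addrA; congr (_ + _).
  by rewrite (big_cat_nat (n := N))//= leqW.
have splitN p h : (N <= p)%N -> min_ops 0 p.+1 h = min_ops 0 N (min_ops N (p.+1 - N) h).
  by move=> Np; rewrite -{1}(subnKC (leqW Np)) min_ops_add.
exists N => p q Np Nq x.
have e20 : 0 <= 2 * e1 by rewrite mulr_ge0// ltW.
have H1 : (min_ops 0 p.+1 (shifted_cdf F (u p.+1 x)) 0 <=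
    min_ops 0 N (shifted_cdf F (u N x)) 0 + (2 * e1)%:E)%E.
  rewrite splitN//; apply: le_min_ops_cst => //; first exact: nnmeas_min_ops.
  move=> y; rewrite uE//.
  apply: le_trans (min_ops_shifted_cdf_le F_atomless F_nonneg F_square _ _ _ _ d0 (ltW e10) Fd) _.
  by rewrite leeD2l// lee_fin vs.
have H2 : (min_ops 0 N (shifted_cdf F (u N x)) 0 <=
    min_ops 0 q.+1 (shifted_cdf F (u q.+1 x)) 0 + (2 * e1)%:E)%E.
  rewrite splitN//; apply: le_min_ops_cst => //; first exact: nnmeas_min_ops.
  move=> y; rewrite uE//.
  apply: le_trans (min_ops_shifted_cdf_ge F_atomless F_nonneg F_square N (q.+1 - N) _ _ d0 (ltW e10) Fd) _.
  by rewrite leeD2l// lee_fin vs.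
have arith (A : \bar R) :
    (A + (3 * e1)%:E + (2 * e1)%:E + (2 * e1)%:E + (2 * e1)%:E <= A + e%:E)%E.
  by rewrite -!addeA leeD2l// -!EFinD lee_fin /e1; lra.
apply: le_trans (arith _); apply: le_trans (up p x Np) _.
apply: leeD2r; apply: le_trans H1 _; apply: leeD2r; apply: le_trans H2 _.
by apply: leeD2r; exact: low.
Qed.

End nn_cauchy.

Section density.
Context (R : realType) (F : probability (measurableTypeR R) R) (f : R -> R).
Hypothesis F_density : has_density F f.

Lemma density_atomless t : F [set t] = 0%E.
Proof.
have [_ _ HF] := F_density.
by rewrite HF ?integral_set1//; exact: measurable_set1.
Qed.

Lemma density_modulus e : 0 < e -> exists2 d, 0 < d &
  forall x, mcdf F (x + d) <= mcdf F x + e.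
Proof.
move=> e0; have [mf f0 HF] := F_density.
have fi : (@lebesgue_measure R).-integrable setT (EFin \o f).
  apply/integrableP; split; first exact/measurable_EFinP.
  under eq_integral do rewrite /= ger0_norm//.
  by rewrite -HF// probability_setT ltry.
have [d [d0 Hd]] := integral_normr_continuous fi e0.
have d20 : 0 < d / 2 by rewrite divr_gt0.
exists (d / 2) => // x; rewrite -lerBlDl -mcdf_itv ?lerDl ?(ltW d20)//.
rewrite HF//; apply: le_trans (ltW (Hd `]x, (x + d / 2)]%classic _ _)) => //.
  rewrite le_eqVlt; apply/orP; left; apply/eqP; congr fine.
  by apply: eq_integral => t _; rewrite ger0_norm.
rewrite [X in (X < _)%E]lebesgue_measure_itv /= lte_fin ltrDl d20 -EFinB lte_fin addrAC subrr add0r.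
by rewrite ltr_pdivrMr// ltr_pMr// ltr1n.
Qed.

Lemma variance_square : F.-integrable setT (fun t : R => t%:E) ->
  ('V_F[fun t : R => t] < +oo)%E -> F.-integrable setT (fun t => (t ^+ 2)%:E).
Proof.
move=> F1; rewrite /variance unlock.
set m := fine _ => V.
have mm : measurable_fun [set: measurableTypeR R] (fun t : R => t ^+ 2).
  exact: measurable_funX.
have mV : measurable_fun [set: measurableTypeR R] (fun t : R => (t - m) ^+ 2).
  by apply: measurable_funX; exact: measurable_funB.
have iV : F.-integrable setT (EFin \o (fun t : R => (t - m) ^+ 2)).
  apply/integrableP; split; first exact/measurable_EFinP.
  apply: le_lt_trans V; rewrite unlock; apply: ge0_le_integral => //.
  - by apply: measurableT_comp => //; exact/measurable_EFinP.
  - by apply/measurable_EFinP; apply: (eq_measurable_fun _ _ mV) => t _; rewrite expr2.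
  by move=> t _; rewrite /= lee_fin ger0_norm ?sqr_ge0// expr2.
have i2 := integrableD_real iV (integrable_cst_real F (m ^+ 2)).
apply: le_integrable (integrableZl measurableT 2 i2) => //; first exact/measurable_EFinP.
move=> t _ /=; rewrite lee_fin ger0_norm ?sqr_ge0// ger0_norm; last first.
  by rewrite mulr_ge0// addr_ge0// sqr_ge0.
have := sqr_ge0 (t - 2 * m); nra.
Qed.

Section near0.
Variables (alpha C : R).
Hypotheses (C_gt0 : 0 < C) (alpha_gtN1 : -1 < alpha) (alpha_lt1 : alpha < 1).
Hypothesis f_near0 : f t / t `^ alpha @[t --> 0^'+] --> C.

Lemma powR_half_bounds s : 2^-1 <= s <= 1 -> 2^-1 <= s `^ alpha <= 2.
Proof.
move=> /andP[s2 s1].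
have s0 : 0 < s by apply: lt_le_trans s2; rewrite invr_gt0.
have s01 : 0 < s <= 1 by rewrite s0.
apply/andP; split.
  apply: le_trans s2 _; rewrite -{1}[s]powRr1 ?(ltW s0)//.
  exact: (ger_powR s01 (ltW alpha_lt1)).
apply: (@le_trans _ _ (s `^ (- 1))); first exact: (ger_powR s01 (ltW alpha_gtN1)).
rewrite powR_inv1 ?(ltW s0)// -[leRHS]invrK lef_pV2 ?posrE// invr_gt0//.
Qed.

Lemma density_dyadic : exists2 x0, 0 < x0 & forall x, 0 < x <= x0 ->
  C / 8 * (x * x `^ alpha) <= fine (F `]x / 2, x]%classic) <= 2 * C * (x * x `^ alpha).
Proof.
have [mf f0 HF] := F_density.
have C2 : 0 < C / 2 by rewrite divr_gt0.
have /cvgrPdist_lt /(_ _ C2) [d /= d0 Hd] := f_near0.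
exists (d / 2); first by rewrite divr_gt0.
move=> x /andP[x0 xd].
have x20 : 0 < x / 2 by rewrite divr_gt0.
have x2x : x / 2 < x by rewrite ltr_pdivrMr// ltr_pMr// ltr1n.
have xa0 : 0 < x `^ alpha by rewrite powR_gt0.
have fb t : t \in `]x / 2, x] -> C / 4 * x `^ alpha <= f t <= 4 * C * x `^ alpha.
  rewrite in_itv /= => /andP[xt tx].
  have t0 : 0 < t by apply: lt_trans xt.
  have ta0 : 0 < t `^ alpha by rewrite powR_gt0.
  have : `|C - f t / t `^ alpha| < C / 2.
    apply: Hd => //=; rewrite sub0r normrN gtr0_norm// (le_lt_trans tx)// (le_lt_trans xd)//.
    by rewrite ltr_pdivrMr// ltr_pMr// ltr1n.
  rewrite ltr_norml => /andP[l1 l2].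
  have l3 : C / 2 * t `^ alpha <= f t by rewrite -ler_pdivlMr//; lra.
  have l4 : f t <= 2 * C * t `^ alpha by rewrite -ler_pdivrMr//; lra.
  have tE : t `^ alpha = x `^ alpha * (t / x) `^ alpha.
    by rewrite -powRM ?divr_ge0 ?(ltW t0) ?(ltW x0)// mulrC divfK ?gt_eqF.
  have /powR_half_bounds/andP[b1 b2] : 2^-1 <= t / x <= 1.
    rewrite ler_pdivlMr// ler_pdivrMr// mul1r tx andbT mulrC ltW//.
  move: l3 l4; rewrite tE => l3 l4; apply/andP; split.
    apply: le_trans l3; rewrite (_ : C / 4 * x `^ alpha = C / 2 * (x `^ alpha * 2^-1)); last by field.
    by rewrite ler_wpM2l ?(ltW C2)// ler_wpM2l// (ltW xa0).
  apply: le_trans l4 _; rewrite (_ : 4 * C * x `^ alpha = 2 * C * (x `^ alpha * 2)); last by ring.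
  by rewrite ler_wpM2l ?mulr_ge0 ?(ltW C_gt0)// ler_wpM2l// (ltW xa0).
have lI : lebesgue_measure (`]x / 2, x]%classic : set R) = (x / 2)%:E.
  by rewrite lebesgue_measure_itv /= lte_fin x2x -EFinB; congr (_%:E); field.
have mI : measurable (`]x / 2, x]%classic : set R) by [].
have Ff : F `]x / 2, x]%classic \is a fin_num by rewrite fin_num_measure.
pose J (c : R) := (\int[lebesgue_measure]_(t in (`](x / 2)%R, x]%classic : set (measurableTypeR R))) c%:E)%E.
have JE c : J c = (c * (x / 2))%:E by rewrite /J integral_cst// [X in (_ * X)%E]lI.
have lower : (J (C / 4 * x `^ alpha)%R <= F `](x / 2)%R, x]%classic)%E.
  rewrite HF//; apply: ge0_le_integral => //.
  - by move=> t _; rewrite lee_fin mulr_ge0 ?divr_ge0 ?(ltW C_gt0) ?(ltW xa0).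
  - by apply/measurable_EFinP; exact: measurable_funTS.
  - by move=> t tI; rewrite lee_fin; have /andP[] := fb t tI.
have upper : (F `](x / 2)%R, x]%classic <= J (4 * C * x `^ alpha)%R)%E.
  rewrite HF//; apply: ge0_le_integral => //.
  - by move=> t _; rewrite lee_fin f0.
  - by apply/measurable_EFinP; exact: measurable_funTS.
  - by move=> t tI; rewrite lee_fin; have /andP[] := fb t tI.
move: lower upper; rewrite !JE -(fineK Ff) !lee_fin => lower upper.
apply/andP; split.
  by apply: le_trans lower; rewrite le_eqVlt; apply/orP; left; apply/eqP; field.
by apply: le_trans upper _; rewrite le_eqVlt; apply/orP; left; apply/eqP; field.
Qed.


Lemma geometric_weight_le (s : R) n : 0 <= s <= 1 ->
  (1 - s) ^+ 2 * (\sum_(0 <= k < n) k.+1%:R * s ^+ k) <= 1.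
Proof.
move=> /andP[s0 s1].
have -> : (1 - s) ^+ 2 * (\sum_(0 <= k < n) k.+1%:R * s ^+ k) =
    1 - n.+1%:R * s ^+ n + n%:R * s ^+ n.+1.
  elim: n => [|n IH]; first by rewrite big_geq// mulr0 mul1r expr0 mul0r addr0 subrr.
  rewrite big_nat_recr//= mulrDr IH !exprS -!natr1; ring.
have sn : 0 <= s ^+ n by rewrite exprn_ge0.
have : n%:R * s ^+ n.+1 <= n%:R * s ^+ n.
  by rewrite ler_wpM2l// exprS ler_piMl.
rewrite -natr1 mulrDl mul1r; lra.
Qed.

Hypothesis F_nonneg : F [set t | 0 <= t] = 1%E.
Hypothesis F_square : F.-integrable setT (fun t => (t ^+ 2)%:E).

Let P n t := \sum_(0 <= k < n) min_weight F k t * t ^+ 2.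

Let measurable_P n : measurable_fun [set: measurableTypeR R] (P n).
Proof.
apply: measurable_sum => k; apply: measurable_funM; first exact: measurable_min_weight.
exact: measurable_funX.
Qed.

Let P_ge0 n t : 0 <= P n t.
Proof. by apply: sumr_ge0 => k _; rewrite mulr_ge0 ?sqr_ge0// min_weight_ge0. Qed.

Let PE n t : P n t = (\sum_(0 <= k < n) min_weight F k t) * t ^+ 2.
Proof. by rewrite /P mulr_suml. Qed.

Let P_le_square n t a : 0 <= t <= a -> P n t <= (n%:R * a) ^+ 2.
Proof.
move=> /andP[t0 ta]; rewrite PE exprMn ler_pM ?sqr_ge0//.
- by apply: sumr_ge0 => k _; exact: min_weight_ge0.
- rewrite expr2; apply: (@le_trans _ _ (\sum_(0 <= k < n) n%:R)).
    rewrite !big_nat; apply: ler_sum => k /andP[_ kn].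
    by apply: le_trans (min_weight_le _ _ _) _; rewrite ler_nat.
  by rewrite sumr_const_nat subn0 mulr_natr lexx.
by rewrite ler_sqr ?nnegrE// (le_trans t0).
Qed.

Let P_le_cdf n t c : 0 < c <= mcdf F t -> P n t <= t ^+ 2 / c ^+ 2.
Proof.
move=> /andP[c0 ct].
have m0 : 0 < mcdf F t by apply: lt_le_trans ct.
have s01 : 0 <= survival F t <= 1 by rewrite survival_ge0 survival_le1.
have := geometric_weight_le n s01.
rewrite survival_mcdf opprB addrCA subrr addr0 -survival_mcdf => H.
rewrite PE [leRHS]mulrC ler_wpM2r ?sqr_ge0//.
apply: (@le_trans _ _ (mcdf F t ^- 2)); last first.
  by rewrite lef_pV2 ?posrE ?exprn_gt0// ler_sqr ?nnegrE ?(ltW c0) ?(ltW m0).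
by rewrite -[leRHS]mul1r ler_pdivlMr ?exprn_gt0// mulrC.
Qed.

Let sum_min_square n : ((\sum_(0 <= k < n) min_square F k)%:E = \int[F]_t (P n t)%:E)%E.
Proof.
have iw k := integrable_min_weightM (F := F) k F_square.
suff [iP RP] : F.-integrable setT (EFin \o P n) /\
    (\int[F]_t P n t)%R = \sum_(0 <= k < n) min_square F k.
  by rewrite -RP /Rintegral fineK//; exact: (integrable_fin_num measurableT iP).
elim: n => [|n [iP RP]].
  have -> : P 0 = cst 0 by apply/funext => t; rewrite /P big_geq.
  rewrite big_geq// Rintegral_cst// mul0r; split=> //; exact: finite_measure_integrable_cst.
have -> : P n.+1 = fun t => P n t + min_weight F n t * t ^+ 2.
  by apply/funext => t; rewrite /P big_nat_recr.
split; first exact: integrableD_real.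
by rewrite (RintegralD measurableT iP (iw n)) RP big_nat_recr.
Qed.

Let nonneg_null : F [set t | t < 0] = 0%E.
Proof.
have mp : measurable ([set t | 0 <= t] : set (measurableTypeR R)).
  rewrite (_ : [set t | 0 <= t] = `[0, +oo[%classic)//.
  by apply/seteqP; split => t /=; rewrite in_itv /= andbT.
rewrite (_ : [set t | t < 0] = ~` [set t | 0 <= t]).
  by rewrite probability_setC// F_nonneg subee.
by apply/seteqP; split => t /=; rewrite ltNge => /negP.
Qed.

Lemma min_square_summable :
  exists B, forall n, \sum_(0 <= k < n) min_square F k <= B.
Proof.
have [x0 x00 Hx] := density_dyadic.
have mp x : 0 < x <= x0 -> C / 8 * (x * x `^ alpha) <= mcdf F x.
  move=> xx0; have /andP[+ _] := Hx _ xx0; move=> /le_trans; apply.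
  have /andP[x_gt0 _] := xx0.
  rewrite mcdf_itv; last by rewrite ler_pdivrMr// ler_pMr// ler1n.
  by rewrite lerBlDr lerDl fine_ge0.
pose rho : R := 2^-1 `^ (1 - alpha).
have h01 : (0 < (2^-1 : R)) && ((2^-1 : R) < 1) by rewrite invr_gt0 ltr0n invf_lt1// ltr1n.
have rho0 : 0 < rho by rewrite powR_gt0//; case/andP: h01.
have rho1 : rho < 1.
  have <- : (1 : R) `^ (1 - alpha) = 1 by rewrite powR1.
  apply: gt0_ltr_powR; rewrite ?nnegrE ?subr_gt0//.
  by case/andP: h01.
pose w x := x / x `^ alpha.
have wE x : 0 < x -> w x = x `^ (1 - alpha).
  move=> x_gt0; rewrite powRB ?powRr1 ?(ltW x_gt0)//.
  by apply/implyP => _; rewrite gt_eqF.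
pose x_ j := x0 * 2^-1 ^+ j.
have x_gt0 j : 0 < x_ j by rewrite mulr_gt0// exprn_gt0//; case/andP: h01.
have x_le j : x_ j <= x0.
  by rewrite ler_piMr ?(ltW x00)// exprn_ile1//; case/andP: h01 => ? ?; exact: ltW.
have x_S j : x_ j.+1 = x_ j / 2 by rewrite /x_ exprSr mulrA.
have w_ j : w (x_ j) = w x0 * rho ^+ j.
  elim: j => [|j IH]; first by rewrite /x_ expr0 !mulr1.
  rewrite wE// x_S powRM ?(ltW (x_gt0 j)) ?invr_ge0// -wE// IH exprSr mulrA.
  by [].
have w0 : 0 < w x0 by rewrite wE// powR_gt0.
pose c0 := C / 32.
have c00 : 0 < c0 by rewrite divr_gt0.
pose K := 2 * C / c0 ^+ 2.
have K0 : 0 < K by rewrite divr_gt0 ?mulr_gt0// exprn_gt0.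
pose M2 := (\int[F]_t (t ^+ 2))%R.
have M20 : 0 <= M2 by apply: Rintegral_ge0 => t _; exact: sqr_ge0.
have m00 : 0 < mcdf F x0.
  by apply: lt_le_trans (mp x0 _); rewrite ?x00 ?lexx// mulr_gt0 ?divr_gt0// mulr_gt0// powR_gt0.
pose B0 := M2 / mcdf F x0 ^+ 2.
have piece n x : 0 < x <= x0 ->
    (\int[F]_(t in (`](x / 2)%R, x]%classic : set (measurableTypeR R))) (P n t)%:E <= (K * w x)%:E)%E.
  move=> xx0; have /andP[x_gt x_le0] := xx0; have /andP[_ Fx] := Hx _ xx0.
  have xa0 : 0 < x `^ alpha by rewrite powR_gt0.
  have x20 : 0 < x / 2 by rewrite divr_gt0.
  have cx0 : 0 < c0 * (x * x `^ alpha) by rewrite mulr_gt0// mulr_gt0.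
  have cx : c0 * (x * x `^ alpha) <= mcdf F (x / 2).
    apply: le_trans (mp (x / 2) _); last first.
      by rewrite x20 (le_trans _ x_le0)// ler_pdivrMr// ler_pMr// ler1n.
    have := @powR_half_bounds 2^-1; rewrite lexx /= => /(_ _)/andP[].
      by rewrite ltW//; case/andP: h01.
    move=> b _; rewrite (powRM _ (ltW x_gt))// ?invr_ge0//.
    rewrite (_ : c0 * _ = C / 8 * (x / 2 * (x `^ alpha * 2^-1))); last by rewrite /c0; field.
    by rewrite ler_wpM2l ?divr_ge0 ?(ltW C_gt0)// ler_wpM2l ?(ltW x20)// ler_wpM2l// ltW.
  have Pb t : `]x / 2, x]%classic t -> P n t <= x ^+ 2 / (c0 * (x * x `^ alpha)) ^+ 2.
    rewrite /= in_itv /= => /andP[xt tx].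
    have t0 : 0 < t by apply: lt_trans xt.
    apply: (@le_trans _ _ (t ^+ 2 / (c0 * (x * x `^ alpha)) ^+ 2)).
      by apply: P_le_cdf; rewrite cx0 (le_trans cx)// mcdf_nondecreasing// ltW.
    by rewrite ler_wpM2r ?invr_ge0 ?sqr_ge0// ler_sqr ?nnegrE ?(ltW t0) ?(ltW x_gt).
  apply: (@le_trans _ _ (\int[F]_(t in (`](x / 2)%R, x]%classic : set (measurableTypeR R)))
      (x ^+ 2 / (c0 * (x * x `^ alpha)) ^+ 2)%:E)%E).
    apply: ge0_le_integral => //.
    - by move=> t _; rewrite lee_fin.
    - by apply/measurable_EFinP; exact: measurable_funTS.
  rewrite integral_cst// -[X in (_ * X)%E]fineK ?fin_num_measure// -EFinM lee_fin.
  apply: le_trans (ler_wpM2l _ Fx) _; first by rewrite divr_ge0 ?sqr_ge0.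
  by rewrite le_eqVlt; apply/orP; left; apply/eqP; rewrite /K /w; field; rewrite !gt_eqF.
have tail n j : (\int[F]_(t in (`]x_ j, +oo[%classic : set (measurableTypeR R))) (P n t)%:E <=
    (B0 + K * w x0 * ((1 - rho ^+ j) / (1 - rho)))%:E)%E.
  elim: j => [|j IH].
    rewrite expr0 subrr mul0r mulr0 addr0 /x_ expr0 mulr1.
    apply: (@le_trans _ _ (\int[F]_t ((mcdf F x0 ^- 2 * t ^+ 2)%:E))%E).
      apply: (@le_trans _ _ (\int[F]_(t in (`]x0, +oo[%classic : set (measurableTypeR R))) ((mcdf F x0 ^- 2 * t ^+ 2)%:E))%E).
        apply: ge0_le_integral => //.
        - by move=> t _; rewrite lee_fin.
        - by apply/measurable_EFinP; exact: measurable_funTS.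
        - apply/measurable_EFinP; apply: measurable_funM => //; exact: measurable_funX.
        move=> t /=; rewrite in_itv /= andbT => xt; rewrite lee_fin mulrC.
        by apply: P_le_cdf; rewrite m00 mcdf_nondecreasing// ltW.
      apply: ge0_subset_integral => //.
        apply/measurable_EFinP; apply: measurable_funM => //; exact: measurable_funX.
      by move=> t _; rewrite lee_fin mulr_ge0 ?invr_ge0 ?sqr_ge0.
    have i2 : F.-integrable setT (EFin \o (fun t => mcdf F x0 ^- 2 * t ^+ 2)).
      by apply: eq_integrable (integrableZl measurableT (mcdf F x0 ^- 2) F_square).
    rewrite -[leLHS]fineK; last exact: (integrable_fin_num measurableT i2).
    rewrite lee_fin -[leLHS]/(Rintegral _ _ _) RintegralZl// mulrC. 
    by [].
  rewrite x_S.
  have -> : (`]x_ j / 2, +oo[%classic = `]x_ j / 2, x_ j] `|` `]x_ j, +oo[ :> set R).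
    rewrite -itv_bndbnd_setU ?bnd_simp//.
    by rewrite ler_pdivrMr// ler_pMr// ler1n.
  rewrite ge0_integral_setU//=; last 3 first.
  - by apply/measurable_EFinP; exact: measurable_funTS.
  - by move=> t _; rewrite lee_fin.
  - rewrite disj_set2E; apply/eqP/seteqP; split => // t [] /=.
    by rewrite !in_itv /= andbT => /andP[_ tx] xt; have := le_lt_trans tx xt; rewrite ltxx.
  have xj : 0 < x_ j <= x0 by rewrite x_gt0 x_le.
  apply: le_trans (leeD (piece n _ xj) IH) _.
  rewrite -EFinD lee_fin w_ le_eqVlt; apply/orP; left; apply/eqP.
  by rewrite exprS; field; rewrite subr_eq0 gt_eqF.
exists (1 + (B0 + K * w x0 / (1 - rho))) => n.
have [j xj] : exists j, (n%:R * x_ j) ^+ 2 <= 1.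
  exists (Num.truncn (n%:R * x0)).+1; rewrite expr_le1//; last by rewrite mulr_ge0// ltW.
  rewrite /x_ mulrA exprVn ler_pdivrMr ?exprn_gt0// mul1r.
  apply: le_trans (ltW (Num.Theory.truncnS_gt _)) _.
  by rewrite -natrX ler_nat ltnW// ltn_expl.
rewrite -lee_fin sum_min_square.
rewrite -[X in (\int[F]_(t in X) _)%E](itv_setU_setT false (x_ j)).
rewrite ge0_integral_setU//=; last 3 first.
- by apply/measurable_EFinP; exact: measurable_funTS.
- by move=> t _; rewrite lee_fin.
- exact: disjoint_rays.
rewrite EFinD; apply: leeD.
  apply: (@le_trans _ _ (\int[F]_(t in (`]-oo, x_ j]%classic : set (measurableTypeR R))) 1)%E).
    apply: ae_ge0_le_integral => //.
    - by move=> t _; rewrite lee_fin.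
    - by apply/measurable_EFinP; exact: measurable_funTS.
    exists [set t | t < 0]; split => //.
      by rewrite (_ : [set t | t < 0] = `]-oo, 0[%classic).
    move=> t /= /not_implyP[]; rewrite in_itv /= => tx tP.
    rewrite ltNge; apply/negP => t0; apply: tP.
    by rewrite lee_fin (le_trans _ xj)// P_le_square// t0.
  by rewrite integral_cst// mul1e probability_le1.
apply: le_trans (tail n j) _; rewrite lee_fin lerD2l.
have Kw : 0 <= K * w x0 by rewrite mulr_ge0 ?ltW.
rewrite mulrA ler_wpM2r ?invr_ge0 ?subr_ge0 ?(ltW rho1)// ler_piMr//.
by rewrite lerBlDr lerDl exprn_ge0// ltW.
Qed.

End near0.
End density.

Section row_combinatorics.
Context (R : realType).
Variable n : nat.

(* Cities are relabelled so that the candidate tour is 0, 1, ..., n: at step i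
   the unvisited cities are i.+1, ..., n, so the edges examined form row i of the
   strict upper triangle, and the tour is the NN tour iff (i, i.+1) is the
   smallest entry of row i for every i. *)
Definition rest (i : nat) : seq (nat * nat) := [seq (i, j) | j <- iota i.+2 (n - i.+1)].
Definition row i := (i, i.+1) :: rest i.

Fixpoint edges m : seq (nat * nat) := if m is m'.+1 then row m' ++ edges m' else [::].

Definition ok (a : nat * nat -> R) i := all (fun e => a (i, i.+1) < a e) (rest i).
Definition good m (a : nat * nat -> R) := all (ok a) (iota m (n - m)).
Definition len m (a : nat * nat -> R) : R := \sum_(m <= i < n) a (i, i.+1).
Definition nn_functional (g : R -> \bar R) (a : nat * nat -> R) : \bar R :=
  ((good 0 a)%:R%:E * g (len 0 a + a (0%N, n))%R)%E.

Lemma mem_rest i e : (e \in rest i) = (e.1 == i) && (i.+1 < e.2 <= n)%N.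
Proof.
apply/mapP/idP => [[j]|/andP[/eqP <- lt]].
  by rewrite mem_iota => lt -> /=; rewrite eqxx /=; lia.
exists e.2; last by case: e lt.
rewrite mem_iota; lia.
Qed.

Lemma rest_uniq i : uniq (rest i).
Proof. by rewrite map_inj_uniq ?iota_uniq// => x y []. Qed.

Lemma size_rest i : size (rest i) = (n - i.+1)%N.
Proof. by rewrite size_map size_iota. Qed.

Lemma mem_row i e : (i < n)%N -> (e \in row i) = (e.1 == i) && (i < e.2 <= n)%N.
Proof.
move=> i_n; rewrite inE mem_rest; case: e => x y /=.
rewrite xpair_eqE; apply/idP/idP; lia.
Qed.

Lemma mem_edges m e : (m <= n)%N -> (e \in edges m) = (e.1 < m)%N && (e.1 < e.2 <= n)%N.
Proof.
case: e => x y /=; elim: m => [|m IH] mn; first by [].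
rewrite (_ : edges m.+1 = row m ++ edges m)// mem_cat IH ?(ltnW mn)// mem_row//=.
lia.
Qed.

Lemma edges_uniq m : (m <= n)%N -> uniq (edges m).
Proof.
elim: m => // m IH mn; rewrite (_ : edges m.+1 = row m ++ edges m)// cat_uniq IH ?(ltnW mn)//.
rewrite andbT; apply/andP; split.
  by rewrite /row cons_uniq rest_uniq andbT mem_rest /=; lia.
apply/hasPn => e; rewrite mem_edges ?(ltnW mn)// mem_row//; lia.
Qed.

Lemma good_update m a e x : (e.1 < m)%N -> good m (update a e x) = good m a.
Proof.
move=> em; apply: eq_in_all => i; rewrite mem_iota => /andP[mi _].
apply: eq_in_all => e'; rewrite mem_rest => /andP[/eqP e'i _].
rewrite /update (_ : (i, i.+1) == e = false); last by case: e em => ? ? /= ?; rewrite xpair_eqE; lia.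
by rewrite (_ : e' == e = false)//; case: e e' em e'i => ? ? [? ?] /= ? ?; rewrite xpair_eqE; lia.
Qed.

Lemma len_update m a e x : (e.1 < m)%N -> len m (update a e x) = len m a.
Proof.
move=> em; rewrite /len !big_nat; apply: eq_bigr => i /andP[mi _].
by rewrite /update (_ : (i, i.+1) == e = false)//; case: e em => ? ? /= ?; rewrite xpair_eqE; lia.
Qed.

Lemma good_recl m a : (m < n)%N -> good m a = ok a m && good m.+1 a.
Proof. by move=> mn; rewrite /good -(subnSK mn). Qed.

Lemma len_recl m a : (m < n)%N -> len m a = a (m, m.+1) + len m.+1 a.
Proof. by move=> mn; rewrite /len big_ltn. Qed.

Lemma coord_measurable_nn_functional (g : R -> \bar R) : nnmeas g ->
  coord_measurable (nn_functional g).
Proof.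
move=> [mg g0] d Y X mX'.
have mX i : measurable_fun setT (fun y => X y i : R).
  by move=> mT B mB; exact: (mX' i mT B mB).
apply: emeasurable_funM; last first.
  apply: (measurableT_comp mg); apply: measurable_funD => //.
  by apply: measurable_sum => i.
apply/measurable_EFinP; apply: measurable_bool_ring.
rewrite /good; elim: (iota _ _) => //= i s IH.
apply: measurable_and => //; rewrite /ok; elim: (rest i) => //= e r IHr.
by apply: measurable_and => //; exact: measurable_fun_ltr.
Qed.

End row_combinatorics.

Section rows.
Context (R : realType) (F : probability (measurableTypeR R) R).
Hypothesis F_atomless : forall t, F [set t] = 0%E.
Hypothesis F_nonneg : F [set t | 0 <= t] = 1%E.
Hypothesis F_square : F.-integrable setT (fun t => (t ^+ 2)%:E).

Section generic.
Context (I : eqType).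
Local Notation iter_int := (@iter_int R F I).

Lemma iter_int_cat s1 s2 (h : (I -> R) -> \bar R) a :
  iter_int (s1 ++ s2) h a = iter_int s1 (iter_int s2 h) a.
Proof. by elim: s1 a => //= e s IH a; apply: eq_integral => x _; exact: IH. Qed.

Lemma iter_int_above e0 rest (phi : (I -> R) -> \bar R) a : uniq rest -> e0 \notin rest ->
  (forall a, 0 <= phi a)%E ->
  (forall a e x, e \in rest -> phi (update a e x) = phi a) ->
  iter_int rest (fun a => ((all (fun e => a e0 < a e) rest)%:R)%:E * phi a)%E a =
  ((survival F (a e0) ^+ size rest)%:E * phi a)%E.
Proof.
elim: rest phi a => [|e rest IH] phi a /=; first by rewrite expr0.
move=> /andP[er ur]; rewrite inE negb_or => /andP[e0e e0r] phi0 inv.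
pose psi b := ((b e0 < b e)%R%:R%:E * phi b)%E.
have psi0 b : (0 <= psi b)%E by rewrite mule_ge0.
have E1 b : iter_int rest (fun a0 => (((a0 e0 < a0 e) && all (fun e1 => a0 e0 < a0 e1) rest)%:R)%:E * phi a0)%E b =
    ((survival F (b e0) ^+ size rest)%:E * psi b)%E.
  rewrite -IH//.
    congr (iter_int _ _ _); apply/funext => b'.
    by rewrite /psi muleA -EFinM -natrM mulnb andbC.
  move=> b' e' x e'r; rewrite /psi inv ?inE ?e'r ?orbT// /update.
  rewrite (_ : (e0 == e') = false); last by apply/eqP => e0e'; rewrite e0e' e'r in e0r.
  by rewrite (_ : (e == e') = false)//; apply/eqP => ee'; rewrite ee' e'r in er.
transitivity (\int[F]_x (((a e0 < x)%R%:R)%:E * ((survival F (a e0) ^+ size rest)%:E * phi a)))%E.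
  apply: eq_integral => x _; rewrite E1 /psi inv ?mem_head//.
  by rewrite /update (negbTE e0e) eqxx muleCA.
rewrite ge0_integralZr//.
- rewrite (_ : (\int[F]_x _ = (survival F (a e0))%:E)%E); first by rewrite muleA -EFinM -exprS.
  rewrite survivalE -[X in F X]setIT -integral_indic//; apply: eq_integral => t _.
  by rewrite indic_ray.
- by apply/measurable_EFinP; exact: measurable_ltrR.
- by rewrite mule_ge0// lee_fin exprn_ge0// survival_ge0.
Qed.

End generic.

Local Notation iter_int := (@iter_int R F (nat * nat)%type).
Variable n : nat.
Local Notation good := (good n).
Local Notation len := (len n).
Local Notation row := (row n).
Local Notation rest := (rest n).

Lemma iter_int_row m (psi : R -> \bar R) a : (m < n)%N -> nnmeas psi ->
  iter_int (row m) (fun a => (good m a)%:R%:E * psi (len m a))%E a =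
  ((good m.+1 a)%:R%:E * ((n - m)%:R^-1%:E * min_op F (n - m.+1) psi (len m.+1 a)))%E.
Proof.
move=> mn gpsi; have [mpsi psi0] := gpsi.
pose phi a := ((good m.+1 a)%:R%:E * psi (len m a))%E.
transitivity (\int[F]_x ((survival F x ^+ (n - m.+1))%:E * phi (update a (m, m.+1) x)))%E.
  apply: eq_integral => x _.
  rewrite -[in RHS]size_rest -{2}[x](_ : update a (m, m.+1) x (m, m.+1) = x); last by rewrite /update eqxx.
  rewrite -iter_int_above ?rest_uniq//.
  - congr (iter_int _ _ _); apply/funext => b.
    by rewrite /phi good_recl// muleA -EFinM -natrM mulnb.
  - by rewrite mem_rest /=; lia.
  - by move=> b; rewrite mule_ge0.
  move=> b e y; rewrite mem_rest => /andP[/eqP em lt]; rewrite /phi good_update ?em//.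
  rewrite 2!(len_recl _ mn) len_update ?em//; congr (_ * psi (_ + _)%R)%E.
  by rewrite /update (_ : _ == e = false)//; case: e em lt => ? ? /= ? ?; rewrite xpair_eqE; lia.
transitivity (\int[F]_x ((good m.+1 a)%:R%:E *
    ((n - m)%:R^-1%:E * ((min_weight F (n - m.+1) x)%:E * psi (len m.+1 a + x)%R))))%E.
  apply: eq_integral => x _.
  rewrite /phi good_update//= len_recl// len_update//= {1}/update eqxx.
  rewrite muleCA [in X in (_ * X)%E]addrC; congr (_ * _)%E.
  rewrite muleA -EFinM; congr (_%:E * _)%E.
  by rewrite /min_weight subnSK// mulKf// pnatr_eq0 subn_eq0 -ltnNge.
rewrite ge0_integralZl//.
- congr (_ * _)%E; rewrite ge0_integralZl//.
  + exact: measurable_min_op_integrand.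
  + by move=> x _; exact: min_op_integrand_ge0.
- by apply: emeasurable_funM => //; exact: measurable_min_op_integrand.
- by move=> x _; rewrite mule_ge0//; exact: min_op_integrand_ge0.
Qed.


End rows.

Section all_rows.
Context (R : realType) (F : probability (measurableTypeR R) R).
Hypothesis F_atomless : forall t, F [set t] = 0%E.
Hypothesis F_nonneg : F [set t | 0 <= t] = 1%E.
Hypothesis F_square : F.-integrable setT (fun t => (t ^+ 2)%:E).

Local Notation iter_int := (@iter_int R F (nat * nat)%type).
Variable p : nat.
Local Notation n := p.+2.
Local Notation good := (good n).
Local Notation len := (len n).

Let closing : nat * nat := (0%N, n).
Let rest0 : seq (nat * nat) := [seq (0%N, j) | j <- iota 2 p].

Let rest0E : rest n 0 = rcons rest0 closing.
Proof.
by rewrite /rest subn1 -[n.-1]addn1 iotaD map_cat /= cats1.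
Qed.

Let mem_rest0 e : (e \in rest0) = (e.1 == 0%N) && (1 < e.2 < n)%N.
Proof.
apply/mapP/idP => [[j]|/andP[/eqP e1 lt]].
  by rewrite mem_iota => lt -> /=; lia.
exists e.2; last by case: e e1 lt => ? ? /= ->.
rewrite mem_iota; lia.
Qed.

Lemma iter_int_row0 (g : R -> \bar R) a : nnmeas g ->
  iter_int (row n 0) (nn_functional n g) a =
  ((good 1 a)%:R%:E * (n%:R^-1%:E * last_op F p g (len 1 a)))%E.
Proof.
move=> gg; have [mg g0] := gg.
pose phi b := (\int[F]_z ((b (0%N, 1%N) < z)%R%:R%:E * ((good 1 b)%:R%:E * g (len 0 b + z)%R)))%E.
have natr3 (A B C : bool) : ([&& A, B & C]%:R : R)%:E = (A%:R%:E * (B%:R%:E * C%:R%:E))%E.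
  by rewrite -!EFinM -!natrM !mulnb.
have clE : iter_int (row n 0) (nn_functional n g) a = (\int[F]_x
    iter_int rest0 (iter_int [:: closing] (nn_functional n g)) (update a (0%N, 1%N) x))%E.
  rewrite /row rest0E; apply: eq_integral => x _.
  by rewrite -cats1 -/(iter_int _ _ _) iter_int_cat.
rewrite clE.
have lastE b : iter_int [:: closing] (nn_functional n g) b =
    ((all (fun e => b (0%N, 1%N) < b e) rest0)%:R%:E * phi b)%E.
  rewrite /phi -ge0_integralZl//; last 2 first.
  - apply: emeasurable_funM; first by apply/measurable_EFinP; exact: measurable_ltrR.
    apply: emeasurable_funM => //; apply: (measurableT_comp mg); exact: measurable_funD.
  - by move=> z _; rewrite mule_ge0// mule_ge0// lee_fin.
  apply: eq_integral => z _; rewrite /= /nn_functional.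
  have gz : good 0 (update b closing z) =
      [&& all (fun e => b (0%N, 1%N) < b e) rest0, b (0%N, 1%N) < z & good 1 b].
    rewrite good_recl// /ok rest0E all_rcons /= andbA; congr (_ && _).
      have u1 : update b closing z (0%N, 1%N) = b (0%N, 1%N) by [].
      rewrite u1 {1}/update eqxx andbC; congr (_ && _).
      apply: eq_in_all => e; rewrite mem_rest0 => /andP[_ lt].
      rewrite /update /= (_ : e == closing = false)//.
      by case: e lt => ? ? /= lt; rewrite xpair_eqE; lia.
    by rewrite good_update.
  rewrite gz natr3 -!muleA; congr (_ * (_ * (_ * g _)))%E.
  rewrite {2}/update eqxx; congr (_ + _).
  rewrite /len !big_nat; apply: eq_bigr => i /andP[_ lt].
  by rewrite /update (_ : _ == closing = false)// xpair_eqE; lia.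
transitivity (\int[F]_x ((survival F x ^+ p)%:E * phi (update a (0%N, 1%N) x)))%E.
  apply: eq_integral => x _; rewrite (_ : iter_int [:: closing] _ =
    fun b => ((all (fun e => b (0%N, 1%N) < b e) rest0)%:R%:E * phi b)%E); last first.
    by apply/funext => b; exact: lastE.
  rewrite iter_int_above.
  - by rewrite size_map size_iota /update eqxx.
  - by rewrite map_inj_uniq ?iota_uniq// => ? ? [].
  - by rewrite mem_rest0.
  - by move=> b; apply: integral_ge0 => z _; rewrite mule_ge0// mule_ge0// lee_fin.
  move=> b e y; rewrite mem_rest0 => /andP[/eqP e0 lt]; rewrite /phi.
  apply: eq_integral => z _; rewrite good_update ?e0// {1}/update.
  have -> : (0%N, 1%N) == e = false by case: e e0 lt => ? ? /= ? ?; rewrite xpair_eqE; lia.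
  congr (_ * (_ * g (_ + _)%R))%E.
  rewrite /len !big_nat; apply: eq_bigr => i /andP[_ il].
  rewrite /update (_ : _ == e = false)//.
  by case: e e0 lt => ? ? /= ? ?; rewrite xpair_eqE; lia.
rewrite muleA -EFinM /last_op.
have mker x : measurable_fun [set: measurableTypeR R]
    (fun z => (p.+2%:R * survival F x ^+ p * (x < z)%R%:R)%:E * g (len 1 a + x + z)%R)%E.
  apply: emeasurable_funM; last by apply: (measurableT_comp mg); exact: measurable_funD.
  by apply/measurable_EFinP; apply: measurable_funM => //; exact: measurable_ltrR.
have s0 x : 0 <= p.+2%:R * survival F x ^+ p by rewrite mulr_ge0// exprn_ge0// survival_ge0.
have ker0 x z : (0 <= (p.+2%:R * survival F x ^+ p * (x < z)%R%:R)%:E * g (len 1 a + x + z)%R)%E.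
  by rewrite mule_ge0// lee_fin mulr_ge0.
rewrite -ge0_integralZl//; last 2 first.
- exact: measurable_last_op_inner.
- by move=> x _; apply: integral_ge0.
apply: eq_integral => x _.
pose K1 z := ((x < z)%R%:R%:E * ((good 1 a)%:R%:E * g (len 1 a + x + z)%R))%E.
have -> : phi (update a (0%N, 1%N) x) = (\int[F]_z K1 z)%E.
  apply: eq_integral => z _; rewrite /K1 good_update// {1}/update eqxx.
  congr (_ * (_ * g (_ + _)%R))%E.
  by rewrite len_recl// len_update// {1}/update eqxx addrC.
have mK1 : measurable_fun [set: measurableTypeR R] K1.
  apply: emeasurable_funM; first by apply/measurable_EFinP; exact: measurable_ltrR.
  by apply: emeasurable_funM => //; apply: (measurableT_comp mg); exact: measurable_funD.
have K10 z : (0 <= K1 z)%E by rewrite mule_ge0// ?mule_ge0// lee_fin.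
rewrite -(ge0_integralZl F measurableT mK1); last 2 first.
- by move=> z _; exact: K10.
- by rewrite lee_fin exprn_ge0// survival_ge0.
rewrite -(ge0_integralZl F measurableT (mker x)); last 2 first.
- by move=> z _; exact: ker0.
- by rewrite lee_fin.
apply: eq_integral => z _; rewrite /K1.
rewrite !muleA -!EFinM; congr (_%:E * _)%E.
by field; rewrite -natrD pnatr_eq0.
Qed.

Lemma iter_int_edges (g : R -> \bar R) m a : nnmeas g -> (m < n)%N ->
  iter_int (edges n m.+1) (nn_functional n g) a =
  ((good m.+1 a)%:R%:E * (((n - m.+1)`!%:R / n`!%:R)%:E *
     min_ops F (n - m.+1) m (last_op F p g) (len m.+1 a)))%E.
Proof.
move=> gg; elim: m a => [|m IH] a mn.
  rewrite (_ : edges n 1 = row n 0)//; last by rewrite /edges cats0.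
  rewrite iter_int_row0//; congr (_ * (_%:E * _))%E.
  by rewrite subn1 [in RHS]factS natrM invfM mulrCA divff ?mulr1// pnatr_eq0 -lt0n fact_gt0.
rewrite (_ : edges n m.+2 = row n m.+1 ++ edges n m.+1)// iter_int_cat.
have gl : nnmeas (last_op F p g) by exact: nnmeas_last_op.
pose psi y := (((n - m.+1)`!%:R / n`!%:R)%:E * min_ops F (n - m.+1) m (last_op F p g) y)%E.
have c0 k : 0 <= k`!%:R / n`!%:R :> R by rewrite divr_ge0.
have gpsi : nnmeas psi.
  have [mm m0] := nnmeas_min_ops F (n - m.+1) m gl.
  by split; [exact: emeasurable_funM|move=> y; rewrite mule_ge0// lee_fin].
rewrite (_ : iter_int (edges n m.+1) _ = fun b => ((good m.+1 b)%:R%:E * psi (len m.+1 b))%E); last first.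
  by apply/funext => b; rewrite IH// ltnW.
rewrite iter_int_row//; congr (_ * _)%E.
rewrite /psi (_ : min_op F _ _ _ = (((n - m.+1)`!%:R / n`!%:R)%:E *
    min_ops F (n - m.+2) m.+1 (last_op F p g) (len m.+2 a))%E).
  rewrite muleA -EFinM; congr (_%:E * _)%E.
  have -> : (n - m.+1 = (n - m.+2).+1)%N by lia.
  by rewrite factS natrM mulrA mulrA mulVf ?mul1r// pnatr_eq0.
have gm := nnmeas_min_ops F (n - m.+1) m gl.
rewrite /= (_ : (n - m.+2).+1 = n - m.+1)%N; last by lia.
rewrite -ge0_integralZl ?lee_fin//.
- by apply: eq_integral => x _; rewrite muleCA.
- exact: measurable_min_op_integrand.
- by move=> x _; exact: min_op_integrand_ge0.
Qed.

Lemma iter_int_nn_functional (g : R -> \bar R) a : nnmeas g ->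
  iter_int (edges n n) (nn_functional n g) a =
  ((n`!%:R)^-1%:E * min_ops F 0 p.+1 (last_op F p g) 0)%E.
Proof.
move=> gg; rewrite iter_int_edges// subnn mul1r.
by rewrite /good subnn mul1e /len big_geq.
Qed.

End all_rows.

Section tours.
Context (R : realType) (F : probability (measurableTypeR R) R).
Hypothesis F_atomless : forall t, F [set t] = 0%E.
Hypothesis F_nonneg : F [set t | 0 <= t] = 1%E.
Hypothesis F_square : F.-integrable setT (fun t => (t ^+ 2)%:E).

Lemma goodP n (a : nat * nat -> R) :
  reflect (forall i j, (i < n)%N -> (i.+1 < j <= n)%N -> a (i, i.+1) < a (i, j)) (good n 0 a).
Proof.
apply: (iffP allP) => [H i j i_n ij|H i].
  have hi : i \in iota 0 (n - 0) by rewrite mem_iota subn0.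
  have /allP/(_ (i, j)) := H i hi.
  by rewrite mem_rest /= eqxx ij; apply.
rewrite mem_iota subn0 add0n => /andP[_ i_n]; apply/allP => -[i' j].
by rewrite mem_rest /= => /andP[/eqP -> ij]; exact: H.
Qed.

Section relabelled.
Variable n : nat.
Implicit Types (s : 'S_n.+1) (l : 'I_n.+1 -> 'I_n.+1 -> R).

Definition relabel s l (e : nat * nat) : R := l (s (inord e.1)) (s (inord e.2)).

Lemma good_NN_tour s l (v : nat -> 'I_n.+1) : s ord0 = ord0 ->
  is_NN_tour l v -> good n 0 (relabel s l) -> forall i, (i <= n)%N -> v i = s (inord i).
Proof.
move=> s0 [v0 vn vstep] /goodP nnmeas_; elim/ltn_ind => -[_ _|i IH i_n].
  by rewrite v0 -s0; congr (s _); apply/val_inj; rewrite /= inordK.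
have [unv vmin] := vstep i i_n.
pose u := (s^-1)%g (v i.+1).
have su : s u = v i.+1 by rewrite permKV.
have iu : (i < u)%N.
  rewrite ltnNge; apply/negP => ui.
  have un : (u < i.+1)%N by rewrite ltnS.
  apply: (unv u ui); rewrite (IH u un) ?inord_val//.
  exact: leq_trans ui (ltnW i_n).
have := leq_trans iu (leqnn _); rewrite leq_eqVlt => /orP[/eqP iu'|iu'].
  by rewrite -su; congr (s _); rewrite iu' inord_val.
have un : (u <= n)%N by rewrite -ltnS ltn_ord.
have vi : v i = s (inord i) by rewrite (IH i (ltnSn i) (ltnW i_n)).
have := nnmeas_ i u i_n; rewrite iu' un => /(_ isT); rewrite /relabel /= inord_val su -vi.
rewrite ltNge vmin// => k ki sk.
have kn : (k <= n)%N by apply: leq_trans ki (ltnW i_n).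
have ki1 : (k < i.+1)%N by rewrite ltnS.
move: sk; rewrite (IH k ki1 kn) => /perm_inj/(congr1 val) /=.
rewrite !inordK ?ltnS// => ki'; by rewrite ki' ltnn in ki.
Qed.

Lemma good_tour_length s l (v : nat -> 'I_n.+1) : s ord0 = ord0 ->
  (forall a b, l a b = l b a) ->
  is_NN_tour l v -> good n 0 (relabel s l) ->
  tour_length l v = len n 0 (relabel s l) + relabel s l (0%N, n).
Proof.
move=> s0 lsym vNN gs; have vE := good_NN_tour s0 vNN gs.
have [v0 vn _] := vNN.
rewrite /tour_length big_ord_recr /= vn vE// /len big_mkord; congr (_ + _).
  by apply: eq_bigr => i _; rewrite !vE// ltnW.
rewrite /relabel lsym; congr l; rewrite -[LHS]s0; congr (s _).
by apply/val_inj; rewrite /= inordK.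
Qed.

Lemma good_unique s s' l (v : nat -> 'I_n.+1) : s ord0 = ord0 -> s' ord0 = ord0 ->
  is_NN_tour l v -> good n 0 (relabel s l) -> good n 0 (relabel s' l) -> s = s'.
Proof.
move=> s0 s0' vNN gs gs'; apply/permP => i.
have := good_NN_tour s0 vNN gs; have := good_NN_tour s0' vNN gs'.
move=> /(_ i) + /(_ i); rewrite -ltnS ltn_ord inord_val => /(_ isT) -> /(_ isT) //.
Qed.

Lemma card_perm_fix0 : #|[pred s : 'S_n.+1 | s ord0 == ord0]| = n`!.
Proof.
rewrite -[n in RHS](_ : #|[set~ (ord0 : 'I_n.+1)]%SET| = n); last by rewrite cardsC1 card_ord.
rewrite -card_perm; apply: eq_card => s; rewrite inE.
apply/idP/idP => [/eqP s0|/out_perm son].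
  by apply/fintype.subsetP => x; rewrite !inE; apply: contraNneq => ->; rewrite s0.
by rewrite son// !inE eqxx.
Qed.

End relabelled.

Section law.
Variable p : nat.
Local Notation n := p.+2.
Context (d : measure_display) (T : measurableType d) (P : probability T R).
Variable L : 'I_n.+1 -> 'I_n.+1 -> {RV P >-> R}.
Hypothesis HL : mean_field_distances F L.

Let X (s : 'S_n.+1) (w : T) : nat * nat -> measurableTypeR R :=
  relabel s (fun i j => L i j w).

Let mX s e : measurable_fun setT (fun w => X s w e).
Proof.
move=> mT B mB; rewrite setTI.
exact: (@measurable_funPTI _ _ _ _ (L (s (inord e.1)) (s (inord e.2))) B mB).
Qed.

Let edge (s : 'S_n.+1) (e : nat * nat) : 'I_n.+1 * 'I_n.+1 :=
  let a := s (inord e.1) in let b := s (inord e.2) in if (a < b)%N then (a, b) else (b, a).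

Let X_edge s w e : X s w e = L (edge s e).1 (edge s e).2 w.
Proof.
have [Lsym _ _] := HL.
by rewrite /X /relabel /edge; case: ifP => //= _; rewrite Lsym.
Qed.

Let edge_lt s e : e \in edges n n -> ((edge s e).1 < (edge s e).2)%N.
Proof.
rewrite mem_edges// => /and3P[e1 e12 e2]; rewrite /edge.
have [//|H] := ltnP (s (inord e.1)) (s (inord e.2)); rewrite /=.
rewrite ltn_neqAle H andbT; apply: contraTneq e12 => /val_inj/perm_inj/(congr1 val) /=.
rewrite !inordK ?ltnS//; first by move=> ->; rewrite ltnn.
exact: ltnW.
Qed.

Let edge_inj s : {in edges n n &, injective (edge s)}.
Proof.
move=> [i j] [i' j']; rewrite !mem_edges//= => /and3P[i1 ij j2] /and3P[i1' ij' j2'].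
have in' : (i < n.+1)%N by rewrite ltnS ltnW.
have in'' : (i' < n.+1)%N by rewrite ltnS ltnW.
have inord_eq x y : (x < n.+1)%N -> (y < n.+1)%N -> inord x = inord y :> 'I_n.+1 -> x = y.
  by move=> xn yn /(congr1 val); rewrite /= !inordK.
rewrite /edge /=; do 2 case: ifP => _; case=> /perm_inj e1 /perm_inj e2.
- by rewrite (inord_eq _ _ in' in'' e1) (inord_eq j j' _ _ e2).
- have := inord_eq _ _ in' _ e1; have := inord_eq _ _ _ in'' e2; rewrite ?ltnS//.
  by move=> /(_ j2) ji /(_ j2') ij''; lia.
- have := inord_eq _ _ _ in'' e1; have := inord_eq _ _ in' _ e2; rewrite ?ltnS//.
  by move=> /(_ j2') ji /(_ j2) ij''; lia.
- by rewrite (inord_eq _ _ in' in'' e2) (inord_eq j j' _ _ e1).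
Qed.

Let X_box s (B : nat * nat -> set (measurableTypeR R)) : (forall i, measurable (B i)) ->
  P [set w | forall i, i \in edges n n -> B i (X s w i)] =
  (P setT * \prod_(i <- edges n n) F (B i))%E.
Proof.
move=> mB; have [Lsym LF Lind] := HL.
rewrite probability_setT mul1e.
pose es := map (edge s) (edges n n).
have ues : uniq es by rewrite map_inj_in_uniq ?edges_uniq//; exact: edge_inj.
pose B' e' := B (nth (0%N, 0%N) (edges n n) (index e' es)).
have B'E e : e \in edges n n -> B' (edge s e) = B e.
  move=> ee; have ie : edge s e \in es by exact: map_f.
  have isz : (index (edge s e) es < size (edges n n))%N by rewrite -(size_map (edge s)) index_mem.
  rewrite /B'; congr B; apply: (@edge_inj s); rewrite ?mem_nth//.
  by rewrite -(nth_map _ (edge s (0%N, 0%N)))// nth_index.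
have sub : ([set x in es] \subset [set ij : 'I_n.+1 * 'I_n.+1 | (ij.1 < ij.2)%N])%SET.
  by apply/fintype.subsetP => e'; rewrite !finset.in_set => /mapP[e ee ->]; exact: edge_lt.
have mB' i : i \in [set x in es]%SET -> measurable (B' i : set R) by move=> _; exact: mB.
have E1 := Lind _ B' sub mB'.
transitivity (P (\bigcap_(i in [set` [set x in es]%SET])
    ((fun w => L i.1 i.2 w) @^-1` B' i))).
  congr (P _); apply/seteqP; split => w /= Hw.
    move=> e' /=; rewrite finset.in_set => /mapP[e ee ->].
    by rewrite /= B'E// -X_edge; exact: Hw.
  move=> e ee; have := Hw (edge s e); rewrite /= finset.in_set map_f// => /(_ isT).
  by rewrite B'E// -X_edge.
rewrite E1 (eq_bigl (mem es)); last by move=> e'; rewrite finset.in_set.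
rewrite -big_uniq// big_map big_seq [RHS]big_seq; apply: eq_bigr => e ee.
by rewrite B'E// -(LF _ _ _ (edge_lt s ee) (mB e)).
Qed.

Let nn_mass (g : R -> \bar R) := min_ops F 0 p.+1 (last_op F p g) 0.

Let integral_nn_functional s g : nnmeas g ->
  (\int[P]_w nn_functional n g (X s w) = (n`!%:R)^-1%:E * nn_mass g)%E.
Proof.
move=> gg.
have h0 a : (0 <= nn_functional n g a)%E by rewrite mule_ge0//; exact: gg.2.
have := @independent_integral R F _ (edges n n) (edges_uniq (leqnn n)) _ _ P (X s) (mX s) (X_box s)
  _ (coord_measurable_nn_functional n gg) h0 (fun=> 0).
rewrite iter_int_nn_functional// [X in (X * _)%E](@probability_setT _ _ _ P) mul1e => <-.
apply: eq_integral => w _; rewrite /nn_functional.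
have spl i j : (i < n)%N -> (i < j <= n)%N -> splice (edges n n) (fun=> 0) (X s w) (i, j) = X s w (i, j).
  by move=> i_n ij; rewrite /splice mem_edges// i_n ij.
congr (_%:R%:E * g (_ + _)%R)%E.
- congr nat_of_bool; apply/goodP/goodP => H i j i_n ij; have := H i j i_n ij.
    by rewrite !spl//; lia.
  by rewrite !spl//; lia.
- by rewrite /len !big_nat; apply: eq_bigr => i /andP[_ i_n]; rewrite spl//; lia.
by rewrite spl//= leqnn.
Qed.

Lemma nn_tour_expectation (v : T -> nat -> 'I_n.+1) (TNN : {RV P >-> R})
  (v_NN : forall w, is_NN_tour (fun i j => L i j w) (v w))
  (TNN_length : forall w, TNN w = tour_length (fun i j => L i j w) (v w))
  (g : R -> \bar R) : nnmeas g ->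
  (\int[P]_w g (TNN w) = min_ops F 0 p.+1 (last_op F p g) 0)%E.
Proof.
have [Lsym _ _] := HL.
pose D w := [exists s : 'S_n.+1, (s ord0 == ord0) && good n 0 (X s w)].
have sumE h w : \sum_(s : 'S_n.+1 | s ord0 == ord0) nn_functional n h (X s w) =
    ((D w)%:R%:E * h (TNN w))%E.
  have [/existsP[s /andP[/eqP s0 gs]]|/existsPn nD] := boolP (D w).
    rewrite (bigD1 s) ?s0//= big1 ?adde0; last first.
      move=> s' /andP[/eqP s0' ss']; rewrite /nn_functional.
      have [gs'|_] := boolP (good n 0 (X s' w)); last by rewrite mul0e.
      by move: ss'; rewrite (good_unique s0' s0 (v_NN w) gs' gs) eqxx.
    rewrite /nn_functional gs TNN_length (good_tour_length s0 _ (v_NN w) gs)//.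
  transitivity (0%E : \bar R); last by rewrite mul0e.
  apply: big1 => s s0; rewrite /nn_functional.
  by have := nD s; rewrite s0 /= => /negbTE ->; rewrite mul0e.
have DE h : nnmeas h -> (\int[P]_w ((D w)%:R%:E * h (TNN w)) = nn_mass h)%E.
  move=> gh; have [mnn nn0] := nnmeas_min_ops F 0 p.+1 (nnmeas_last_op F p gh).
  pose ss := [seq s : {perm 'I_n.+1} <- index_enum {perm 'I_n.+1} | s ord0 == ord0].
  transitivity (\int[P]_w (\sum_(s <- ss) nn_functional n h (X s w)))%E.
    by apply: eq_integral => w _; rewrite -sumE big_filter.
  rewrite ge0_integral_sum//; last 2 first.
  - move=> s; exact: (coord_measurable_nn_functional n gh (mX s)).
  - by move=> s w _; rewrite mule_ge0//; exact: gh.2.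
  rewrite (eq_bigr (fun=> 1%E * ((n`!%:R)^-1%:E * nn_mass h))%E); last first.
    by move=> s _; rewrite integral_nn_functional// mul1e.
  rewrite -ge0_sume_distrl// big_filter sumEFin.
  have -> : \sum_(s : {perm 'I_n.+1} | s ord0 == ord0) (1 : R) = n`!%:R.
    by rewrite -(card_perm_fix0 n) -sumr_const; apply: eq_bigl => s; rewrite inE.
  by rewrite muleA -EFinM divff ?mul1e// pnatr_eq0 -lt0n fact_gt0.
have g1 : nnmeas (fun _ : R => 1%E) by exact: nnmeas_cst.
have mD : measurable_fun setT (fun w => (D w)%:R : R).
  apply/measurable_EFinP.
  pose ss := [seq s : {perm 'I_n.+1} <- index_enum {perm 'I_n.+1} | s ord0 == ord0].
  rewrite (_ : EFin \o _ = fun w => \sum_(s <- ss) nn_functional n (fun=> 1%E) (X s w)).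
    apply: emeasurable_sum => s; exact: (coord_measurable_nn_functional n g1 (mX s)).
  by apply/funext => w; rewrite big_filter sumE mule1.
have PD : (\int[P]_w (D w)%:R%:E = 1)%E.
  under eq_integral do rewrite -[_%:E]mule1.
  rewrite (DE _ g1) /nn_mass.
  rewrite (_ : last_op F p _ = fun=> 1%E); last by apply/funext => y; rewrite last_op1.
  by rewrite min_ops_cst.
pose DT := [set w | D w].
have mDT : measurable DT.
  rewrite (_ : DT = (fun w => (D w)%:R : R) @^-1` [set 1]).
    by rewrite -[X in measurable X]setTI; exact: mD.
  by apply/seteqP; split => w /=; rewrite /DT /=; case: (D w) => // /eqP; rewrite eq_sym oner_eq0.
have PDT : P DT = 1%E.
  rewrite -PD -[X in P X]setIT -integral_indic//; apply: eq_integral => w _.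
  rewrite indicE; congr (nat_of_bool _)%:R%:E; apply/idP/idP; rewrite inE//.
move=> gg; have [mg g0] := gg.
have mT : measurable_fun setT (TNN : T -> R) by exact: measurable_funP.
rewrite -/(nn_mass g) -(DE _ gg); apply: ge0_ae_eq_integral => //.
- exact: (measurableT_comp mg).
- apply: emeasurable_funM; first exact/measurable_EFinP.
  exact: (measurableT_comp mg).
- by move=> w _; rewrite mule_ge0// lee_fin.
have PC : P (~` DT) = 0%E by rewrite probability_setC// PDT subee.
exists (~` DT); split => //; first exact: measurableC.
move=> w /= nw; apply: contra_not nw => Dw _; rewrite [D w]Dw mul1e//.
Qed.

End law.
End tours.

Section centred_tour.
Context (R : realType) (F : probability (measurableTypeR R) R).
Hypothesis F_atomless : forall t, F [set t] = 0%E.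
Hypothesis F_nonneg : F [set t | 0 <= t] = 1%E.
Hypothesis F_square : F.-integrable setT (fun t => (t ^+ 2)%:E).
Variable p : nat.
Context (d : measure_display) (T : measurableType d) (P : probability T R).
Variable L : 'I_p.+3 -> 'I_p.+3 -> {RV P >-> R}.
Hypothesis L_iid : mean_field_distances F L.
Variables (v : T -> nat -> 'I_p.+3) (TNN : {RV P >-> R}).
Hypothesis v_NN : forall w, is_NN_tour (fun i j => L i j w) (v w).
Hypothesis TNN_length : forall w, TNN w = tour_length (fun i j => L i j w) (v w).

Lemma expectation_NN_tour : ('E_P[TNN] = (nn_mean F p)%:E)%E.
Proof.
have E := nn_tour_expectation F_atomless F_nonneg F_square L_iid v_NN TNN_length.
rewrite unlock integralE.
have gneg : nnmeas (fun y : R => (Num.max (- y) 0)%:E).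
  split=> [|y]; last by rewrite lee_fin le_max lexx orbT.
  by apply/measurable_EFinP; apply: measurable_maxr => //; exact: measurable_funN.
have -> : (\int[P]_w (EFin \o TNN)^\+ w = \int[P]_w pos_part (TNN w))%E.
  by apply: eq_integral => w _; rewrite funeposE -EFin_max.
have -> : (\int[P]_w (EFin \o TNN)^\- w = \int[P]_w (Num.max (- TNN w) 0)%:E)%E.
  by apply: eq_integral => w _; rewrite funenegE -EFinN -EFin_max.
have := E _ gneg; rewrite (E _ (nnmeas_pos_part R)) => ->; rewrite min_ops_last_op_pos//.
rewrite min_ops_vanish ?sube0//; first exact: nnmeas_last_op.
move=> y y0; apply: last_op_vanish => // z z0; congr EFin.
by apply/max_idPr; rewrite oppr_le0.
Qed.

Lemma mcdf_centred_NN_tour (X : {RV P >-> measurableTypeR R}) x :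
  (forall w, X w = TNN w - fine ('E_P[TNN])%E) ->
  (mcdf (distribution P X) x)%:E = nn_cdf F p x.
Proof.
move=> XE; rewrite /mcdf fineK ?fin_num_measure//.
rewrite /nn_cdf -(nn_tour_expectation F_atomless F_nonneg F_square L_iid v_NN TNN_length).
  2: exact: nnmeas_below.
have mA : measurable (X @^-1` `]-oo, x]%classic).
  by rewrite -[X in measurable X]setTI; apply: (@measurable_funPT _ _ _ _ X).
transitivity (P (X @^-1` `]-oo, x]%classic `&` setT)); first by rewrite setIT.
rewrite -integral_indic//.
apply: eq_integral => w _; rewrite /below; congr EFin.
rewrite (_ : \1_(_ @^-1` _) w = \1_(`]-oo, x]%classic) (X w))//.
by rewrite indic_rayN XE expectation_NN_tour lerBlDr.
Qed.

End centred_tour.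

Theorem theorem2p1 (R : realType)
  (F : probability (measurableTypeR R) R) (f : R -> R) (alpha C : R)
  (F_nonneg : F [set t | 0 <= t] = 1%E)
  (F_mean : F.-integrable setT (fun t : R => t%:E))
  (F_variance : ('V_F[fun t : R => t] < +oo)%E)
  (F_density : has_density F f)
  (C_gt0 : 0 < C) (alpha_gtN1 : -1 < alpha) (alpha_lt1 : alpha < 1)
  (f_near0 : f t / t `^ alpha @[t --> 0^'+] --> C)
  (d : nat -> measure_display) (Omega : forall n, measurableType (d n))
  (P : forall n, probability (Omega n) R)
  (L : forall n, 'I_n.+1 -> 'I_n.+1 -> {RV (P n) >-> R})
  (L_iid : forall n, mean_field_distances F (@L n))
  (v : forall n, Omega n -> nat -> 'I_n.+1)
  (v_NN : forall n w, is_NN_tour (fun i j => L n i j w) (@v n w))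
  (TNN : forall n, {RV (P n) >-> R})
  (TNN_length : forall n w,
     TNN n w = tour_length (fun i j => L n i j w) (@v n w)) :
  exists mu : probability (measurableTypeR R) R,
    converges_weakly_to P
      (fun n w => TNN n w - fine ('E_(P n)[TNN n])%E) mu.
Proof.
have F_square := variance_square F_mean F_variance.
have F_atomless := density_atomless F_density.
have F_modulus := density_modulus F_density.
have F_sum := min_square_summable F_density C_gt0 alpha_gtN1 alpha_lt1 f_near0 F_nonneg F_square.
pose X n w := TNN n w - fine ('E_(P n)[TNN n])%E.
have mX n : measurable_fun setT (X n : Omega n -> measurableTypeR R).
  move=> mT B mB; apply: (_ : measurable_fun [set: Omega n] (X n : _ -> R)) => //.
  exact: measurable_funB.
pose Xm n := isMeasurableFun.Build _ _ (Omega n) (measurableTypeR R) (X n) (mX n).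
pose XX n : {RV (P n) >-> measurableTypeR R} := HB.pack (X n) (Xm n).
apply: (@weak_limit_of_uniform_cauchy_cdf _ _ _ P XX) => e e0.
have [N HN] := nn_cdf_cauchy F_atomless F_nonneg F_square F_modulus F_sum e0.
exists N.+2 => -[|[|p]]// [|[|q]]// Np Nq x.
rewrite -lee_fin EFinD.
rewrite !(mcdf_centred_NN_tour F_atomless F_nonneg F_square (L_iid _) (@v_NN _) (@TNN_length _))//.
exact: HN.
Qed.
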